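(* Let $F$ be a continuous distribution function on $\mathcal{X}\subseteq\mathbb{R}^p$ with finite energy distances. Suppose $n=\sum_{k=1}^K n_k(n)$ and $\lim_{n\to\infty}\frac{n_k(n)}{n}=c_k>0$ for all $k=1,\ldots,K$. Suppose that the point set $\mathcal{P}_n^*$ is a representative point set of $F$ under the energy distance criterion, i.e. $$E(F,F_{\mathcal{P}_n^*})=\min_{\mathcal{P}_n\subseteq\mathcal{X}}E(F,F_{\mathcal{P}_n}),$$ and that the subsets $\mathcal{P}^*_{n_1(n)},\ldots,\mathcal{P}^*_{n_K(n)}$ of $\mathcal{P}_n^*$ solve the partitioning problem $$\min_{\mathcal{P}_{n_1},\ldots,\mathcal{P}_{n_K}\subseteq\mathcal{P}_n^*}\ \sum_{k=1}^K\frac{n_k}{n}E(F,F_{\mathcal{P}_{n_k}})\quad\text{s.t.}\quad\bigcup_{k=1}^K\mathcal{P}_{n_k}=\mathcal{P}_n^*,\quad\sum_{k=1}^K n_k=n,$$ where $n_k=n_k(n)$ is the prescribed number of points of $\mathcal{P}_{n_k}$. Then $F_{\mathcal{P}^*_{n_k(n)}}\stackrel{d}{\longrightarrow}F$ as $n\to\infty$ for every $k=1,\ldots,K$.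
   Context: Point sets are finite indexed families of points (repetitions allowed and counted with multiplicity); the subsets in the partitioning problem arise from partitions of the index set of $\mathcal{P}_n^*$ into $K$ blocks of sizes $n_1(n),\dots,n_K(n)$. $F_{\mathcal{P}}$ denotes the empirical distribution function of a point set $\mathcal{P}$. $K$ is fixed; $n_k(n)$ is a positive integer depending on the total sample size $n$. A minimum over $\mathcal{P}_n\subseteq\mathcal{X}$ ranges over all $n$-point sets in $\mathcal{X}$. For $Y,Y'\stackrel{i.i.d.}{\sim}F$, the energy distance between $F$ and $F_{\mathcal{P}_n}$, $\mathcal{P}_n=\{\boldsymbol{x}_i\}_{i=1}^n$, is $$E(F,F_{\mathcal{P}_n})=\frac{2}{n}\sum_{i=1}^n\mathbb{E}\|\boldsymbol{x}_i-Y\|_2-\frac{1}{n^2}\sum_{i=1}^n\sum_{j=1}^n\|\boldsymbol{x}_i-\boldsymbol{x}_j\|_2-\mathbb{E}\|Y-Y'\|_2 ,$$ assuming these expectations are finite. *)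

(* Defs.v *)
From HB Require Import structures.
From mathcomp Require Import all_boot all_order all_algebra.
From mathcomp Require Import all_classical all_reals all_analysis.

Set Implicit Arguments.
Unset Strict Implicit.
Unset Printing Implicit Defensive.

Import Order.TTheory GRing.Theory Num.Theory.
Import numFieldNormedType.Exports.

Local Open Scope ring_scope.

(* The library puts a topology on matrices but no sigma-algebra; we equip them,
   hence R^p = 'rV[R]_p, with the Borel sigma-algebra of that topology. *)
Section borel_matrix.
Context {R : realType} {m n : nat}.

Let borel : set_system 'M[R]_(m, n) := <<s open >>%classic.

Let borel0 : borel set0.
Proof. exact: sigma_algebra0. Qed.

Let borelC A : borel A -> borel (~` A)%classic.
Proof. exact: sigma_algebraC. Qed.

Let borel_bigcup (A : nat -> set 'M[R]_(m, n)) :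
  (forall i, borel (A i)) -> borel (\bigcup_i A i)%classic.
Proof. exact: sigma_algebra_bigcup. Qed.

Definition matrix_display : measure_display := default_measure_display.

HB.instance Definition _ :=
  @isMeasurable.Build matrix_display 'M[R]_(m, n) borel borel0 borelC borel_bigcup.

End borel_matrix.

Section energy_distance.
Context {R : realType} {p : nat}.
Implicit Types (P : probability 'rV[R]_p R) (X : set 'rV[R]_p).

(* The library norm on matrices is the sup norm. *)
Definition enorm (v : 'rV[R]_p) : R := Num.sqrt (\sum_j v 0 j ^+ 2).

Definition lower_orthant (t : 'rV[R]_p) : set 'rV[R]_p :=
  [set y : 'rV[R]_p | forall j, y 0 j <= t 0 j]%classic.

Definition joint_cdf P (t : 'rV[R]_p) : R := fine (P (lower_orthant t)).

(* E || x - Y || and E || Y - Y' || for Y, Y' i.i.d. of law P: the pair (Y, Y')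
   has law P \x P. *)
Definition mean_dist_to P (x : 'rV[R]_p) : \bar R :=
  ('E_P[fun y => enorm (x - y)])%E.

Definition mean_dist P : \bar R :=
  ('E_(P \x P)[fun z => enorm (z.1 - z.2)])%E.

Definition finite_energy P X : Prop :=
  (forall x, X x -> mean_dist_to P x < +oo)%E /\ (mean_dist P < +oo)%E.

(* A point set is a family x : I -> R^p over a finite index type, so repeated
   points are counted with multiplicity; its subsets are given by sets A of
   indices.  Both notions below are meant for nonempty A, and the values of
   energy are meaningful under finite_energy. *)
Definition edf (I : finType) (x : I -> 'rV[R]_p) (A : {set I})
    (t : 'rV[R]_p) : R :=
  #|A|%:R^-1 * \sum_(i in A) \1_(lower_orthant t) (x i).

Definition energy P (I : finType) (x : I -> 'rV[R]_p) (A : {set I}) : R :=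
  2 / #|A|%:R * (\sum_(i in A) fine (mean_dist_to P (x i)))
  - (#|A|%:R ^+ 2)^-1 * (\sum_(i in A) \sum_(j in A) enorm (x i - x j))
  - fine (mean_dist P).

Definition representative P X (n : nat) (x : 'I_n -> 'rV[R]_p) : Prop :=
  (forall i, X (x i)) /\
  forall y : 'I_n -> 'rV[R]_p, (forall i, X (y i)) ->
    energy P x [set: 'I_n] <= energy P y [set: 'I_n].

Definition block_partition (n K : nat) (m : 'I_K -> nat)
    (B : 'I_K -> {set 'I_n}) : Prop :=
  [/\ forall k, #|B k| = m k,
      forall k l, k != l -> [disjoint B k & B l]
    & \bigcup_k B k = [set: 'I_n]].

Definition partition_cost P (n K : nat) (m : 'I_K -> nat)
    (x : 'I_n -> 'rV[R]_p) (B : 'I_K -> {set 'I_n}) : R :=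
  \sum_k (m k)%:R / n%:R * energy P x (B k).

Definition optimal_partition P (n K : nat) (m : 'I_K -> nat)
    (x : 'I_n -> 'rV[R]_p) (B : 'I_K -> {set 'I_n}) : Prop :=
  block_partition m B /\
  forall C : 'I_K -> {set 'I_n}, block_partition m C ->
    partition_cost P m x B <= partition_cost P m x C.

(* Convergence in distribution, in terms of distribution functions on R^p. *)
Definition cvg_in_distribution (G : nat -> 'rV[R]_p -> R)
    (F : 'rV[R]_p -> R) : Prop :=
  forall t, {for t, continuous F} -> (G n t @[n --> \oo] --> F t)%classic.

End energy_distance.

(* Main.v *)
Require Import Defs.
From mathcomp Require Import all_boot all_order all_algebra.
From mathcomp Require Import all_classical all_reals all_analysis.
From mathcomp Require Import ring lra.
From mathcomp Require Import measurable_realfun.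
From mathcomp Require Import fingroup perm.

(** The energy distance to [P] is a squared Hilbert distance, and everything
    reduces to finite families of weighted points.

    - Negative type.  The Euclidean norm is a mixture of the kernels
      [1 - exp (- (s |v|)^2)] over the scales [s], with respect to [ds / s^2], and
      Gaussian kernels are positive semidefinite.  Hence the form
      [- sum w_i w_j |x_i - x_j|] is nonnegative for weights of total mass zero
      ([dist_form_ge0]), and it controls the sums of every Gaussian against the
      weights ([gauss_sum_cube_le]).

    - From finite families to [P].  Choosing the points of a sample one after the
      other, each no worse than average, realises any bound that holds in mean for
      i.i.d. samples ([exists_sample_le]).  This gives [n] points of energy at most
      [mu / n], where [mu] is the mean distance ([exists_energy_le]), and also an
      empirical substitute for [P] that is as good as [P] for the energy and for
      one test function ([exists_empirical]).  So the energy is nonnegative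
      ([wenergy_ge0]), and small energy forces the averages of Gaussians to be near
      their means ([energy_controls_gauss]).  Products of Gaussians are Gaussians,
      up to a factor; soft unions of narrow Gaussian bumps then approximate
      orthants, and small energy forces the distribution functions to be close
      ([cdf_close]).

    - Partitions.  For a uniformly random partition with prescribed block sizes,
      the mean cost exceeds the energy of the whole set by at most
      [K * sum |x_i - x_j| / n^3] ([partition_cost_le]).  A representative set has
      energy at most [mu / n], and this alone bounds its first moment
      ([first_moment_le]), so the excess is [O(1 / n)].  The optimal cost is thus
      [O(1 / n)].  The energies of the blocks are nonnegative and their weights
      have positive limits, so each of these energies tends to zero, and the
      distribution functions of the blocks converge. *)

Set Implicit Arguments.
Unset Strict Implicit.
Unset Printing Implicit Defensive.
Import Order.TTheory GRing.Theory Num.Theory.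
Import numFieldNormedType.Exports.
Local Open Scope ring_scope.

(** * Positivity of Gaussian forms *)

Section finite_sums.
Context {R : realType}.

Lemma sum_unit (f : unit -> R) : \sum_u f u = f tt.
Proof. by rewrite (big_pred1 tt) // => -[]. Qed.

Lemma cvg_finsum (I : finType) {T : Type} (F : set_system T) {FF : Filter F}
    (f : I -> T -> R) (l : I -> R) :
  (forall i, f i t @[t --> F] --> l i)%classic ->
  (\sum_i f i t @[t --> F] --> \sum_i l i)%classic.
Proof.
move=> fl; elim: (index_enum I) => [|i r IH].
  by rewrite big_nil; under eq_fun do rewrite big_nil; exact: cvg_cst.
by rewrite big_cons; under eq_fun do rewrite big_cons; exact: cvgD.
Qed.

Lemma is_derive_finsum (I : finType) (f : I -> R -> R) (df : I -> R) (s : R) :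
  (forall i, is_derive s 1 (f i) (df i)) ->
  is_derive s 1 (fun t => \sum_i f i t) (\sum_i df i).
Proof.
move=> fdf; elim: (index_enum I) => [|i r IH].
  rewrite big_nil; under eq_fun do rewrite big_nil; exact: is_derive_cst.
rewrite big_cons; under eq_fun do rewrite big_cons; exact: is_deriveD.
Qed.

End finite_sums.

Section gaussian.
Context {R : realType} {p : nat}.
Implicit Types (x y z : 'rV[R]_p).

Definition dot x y : R := \sum_j x 0 j * y 0 j.

Definition gauss (s : R) z x : R := expR (- (s * enorm (x - z)) ^+ 2).

Lemma enorm_ge0 x : 0 <= enorm x. Proof. exact: sqrtr_ge0. Qed.

Lemma sqr_enorm x : enorm x ^+ 2 = dot x x.
Proof.
rewrite sqr_sqrtr; first by apply: eq_bigr => j _; rewrite expr2.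
by apply: sumr_ge0 => j _; exact: sqr_ge0.
Qed.

Lemma enormN x : enorm (- x) = enorm x.
Proof. by congr Num.sqrt; apply: eq_bigr => j _; rewrite mxE sqrrN. Qed.

Lemma enormC x y : enorm (x - y) = enorm (y - x).
Proof. by rewrite -enormN opprB. Qed.

Lemma enorm0 : enorm (0 : 'rV[R]_p) = 0.
Proof. by rewrite /enorm big1 ?sqrtr0// => j _; rewrite mxE expr0n. Qed.

Lemma enormxx x : enorm (x - x) = 0. Proof. by rewrite subrr enorm0. Qed.

Lemma sqr_enormB x y :
  enorm (x - y) ^+ 2 = enorm x ^+ 2 + enorm y ^+ 2 - 2 * dot x y.
Proof.
rewrite !sqr_enorm /dot mulr_sumr -big_split/= -sumrB.
by apply: eq_bigr => j _; rewrite !mxE; ring.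
Qed.

Lemma exprn_dot x y n :
  dot x y ^+ n = \sum_(f : {ffun 'I_n -> 'I_p})
    (\prod_i x 0 (f i)) * (\prod_i y 0 (f i)).
Proof.
rewrite -[in LHS](card_ord n) -prodr_const bigA_distr_bigA/=.
by apply: eq_bigr => f _; rewrite big_split.
Qed.

(** Expanding the exponential, the form is a nonnegative combination of squares
    of moments of the weighted points. *)
Lemma exp_dot_form_ge0 (I : finType) (v : I -> R) (x : I -> 'rV[R]_p) (t : R) :
  0 <= t -> 0 <= \sum_i \sum_j v i * v j * expR (t * dot (x i) (x j)).
Proof.
move=> t0.
have cvgS : (\sum_i \sum_j v i * v j * series (exp_coeff (t * dot (x i) (x j))) n
    @[n --> \oo] --> \sum_i \sum_j v i * v j * expR (t * dot (x i) (x j)))%classic.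
  apply: cvg_finsum => i; apply: cvg_finsum => j.
  by apply: cvgZr; exact: is_cvg_series_exp_coeff.
rewrite -(cvg_lim _ cvgS)//; apply: limr_ge; first by apply/cvg_ex; eexists; exact: cvgS.
apply: nearW => n.
have -> : \sum_i \sum_j v i * v j * series (exp_coeff (t * dot (x i) (x j))) n =
   \sum_(k < n) (t ^+ k / k`!%:R) *
     \sum_i \sum_j v i * v j * dot (x i) (x j) ^+ k.
  under [RHS]eq_bigr do (rewrite mulr_sumr; under eq_bigr do rewrite mulr_sumr).
  rewrite [RHS]exchange_big/=; apply: eq_bigr => i _.
  rewrite [RHS]exchange_big/=; apply: eq_bigr => j _.
  rewrite /series/= big_mkord mulr_sumr; apply: eq_bigr => k _.
  by rewrite /exp_coeff/= exprMn; ring.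
apply: sumr_ge0 => k _; apply: mulr_ge0; first by rewrite divr_ge0// exprn_ge0.
under eq_bigr do under eq_bigr do rewrite exprn_dot mulr_sumr.
under eq_bigr do rewrite exchange_big.
rewrite exchange_big; apply: sumr_ge0 => f _.
rewrite (_ : \sum_i _ = (\sum_i v i * \prod_a x i 0 (f a)) ^+ 2) ?sqr_ge0//.
rewrite expr2 mulr_suml; apply: eq_bigr => i _.
by rewrite mulr_sumr; apply: eq_bigr => j _; ring.
Qed.

Definition gauss_form (I : finType) (w : I -> R) (x : I -> 'rV[R]_p) (s : R) : R :=
  \sum_i \sum_j w i * w j * gauss s (x i) (x j).

(** [exp (- s^2 |x - y|^2)] is [exp (2 s^2 x.y)] up to a factor depending on [x]
    times one depending on [y], which the weights absorb. *)
Lemma gauss_form_ge0 (I : finType) (w : I -> R) (x : I -> 'rV[R]_p) (s : R) :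
  0 <= gauss_form w x s.
Proof.
pose v i := w i * expR (- (s * enorm (x i)) ^+ 2).
have s2 : 0 <= 2 * s ^+ 2 by rewrite mulr_ge0// sqr_ge0.
rewrite (le_trans (exp_dot_form_ge0 v x s2))// /gauss_form.
rewrite le_eqVlt; apply/orP; left; apply/eqP.
apply: eq_bigr => i _; apply: eq_bigr => j _; rewrite /v /gauss.
have -> : - (s * enorm (x j - x i)) ^+ 2 = - (s * enorm (x i)) ^+ 2
    - (s * enorm (x j)) ^+ 2 + 2 * s ^+ 2 * dot (x i) (x j).
  rewrite exprMn sqr_enormB (_ : dot (x j) (x i) = dot (x i) (x j)); first by ring.
  by apply: eq_bigr => k _; rewrite mulrC.
by rewrite !expRD; ring.
Qed.

Lemma gaussC s x y : gauss s x y = gauss s y x.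
Proof. by rewrite /gauss enormC. Qed.

Lemma gaussxx s x : gauss s x x = 1.
Proof. by rewrite /gauss enormxx mulr0 expr0n oppr0 expR0. Qed.

Lemma gauss0 x y : gauss 0 x y = 1.
Proof. by rewrite /gauss mul0r expr0n oppr0 expR0. Qed.

Lemma gauss_ge0 s x y : 0 <= gauss s x y. Proof. exact: expR_ge0. Qed.

Lemma gauss_le1 s x y : gauss s x y <= 1.
Proof. by rewrite /gauss expR_le1 oppr_le0 sqr_ge0. Qed.

(** Cauchy--Schwarz for the Gaussian kernel: adding the point [z] with weight
    minus the left-hand sum completes the square. *)
Lemma sqr_gauss_sum_le (I : finType) (w : I -> R) (x : I -> 'rV[R]_p) s z :
  (\sum_i w i * gauss s z (x i)) ^+ 2 <= gauss_form w x s.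
Proof.
set q := \sum_i _.
pose w' (i : I + unit) := if i is inl i then w i else - q.
pose x' (i : I + unit) := if i is inl i then x i else z.
have := gauss_form_ge0 w' x' s.
rewrite /gauss_form big_sumType/=.
under eq_bigr do rewrite big_sumType/=.
rewrite big_split/= big_sumType/=.
rewrite -!/(gauss_form w x s).
under [X in _ + X + _]eq_bigr do rewrite sum_unit.
rewrite !sum_unit gaussxx.
rewrite [X in _ + X + _](_ : _ = - q * q); last first.
  by rewrite {3}/q mulr_sumr; apply: eq_bigr => i _; rewrite gaussC; ring.
rewrite [X in _ + (X + _)](_ : _ = - q * q); last first.
  by rewrite {3}/q mulr_sumr; apply: eq_bigr => i _; ring.
move: (gauss_form w x s) => G; clearbody q; nra.
Qed.

End gaussian.

(** * The Euclidean norm as a mixture of Gaussian kernels *)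

Section norm_as_gaussian_mixture.
Context {R : realType}.
Import gauss_integral_proof.

(** A primitive of [(1 - exp (- r^2)) / r^2] on the positive reals, found by
    integration by parts: the function [s |-> u * mixture_prim (s * u)] then has
    derivative [(1 - exp (- (s u)^2)) / s^2] and increases from [0] to
    [u * sqrt pi], for [u] positive. *)
Definition mixture_prim (r : R) : R :=
  2 * integral0_gauss r - (1 - expR (- r ^+ 2)) / r.

Lemma is_derive_integral0_gauss (r : R) : 0 < r ->
  is_derive r 1 integral0_gauss (expR (- r ^+ 2)).
Proof.
move=> r0.
have [||||d1 d2] := @continuous_FTC1 R gauss_fun (BLeft 0) r (r + 1).
- by rewrite ltrDl.
- apply: continuous_compact_integrable => //; first exact: segment_compact.
  by apply: continuous_subspaceT; exact: continuous_gauss_fun.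
- by rewrite /= lte_fin.
- by move=> ?; exact: continuous_gauss_fun.
by apply: DeriveDef; [exact: d1|rewrite -derive1E; exact: d2].
Qed.

Lemma integral0_gauss_le (r : R) : 0 < r -> integral0_gauss r <= r.
Proof.
move=> r0.
have g00 : integral0_gauss (0 : R) = 0.
  by rewrite /integral0_gauss set_itv1 Rintegral_set1.
have [||c _ E] := @MVT R integral0_gauss (fun t => expR (- t ^+ 2)) 0 r r0.
- by move=> t; rewrite in_itv/= => /andP[t0 _]; exact: is_derive_integral0_gauss.
- apply: parameterized_integral_continuous; first exact: ltW.
  apply: continuous_compact_integrable => //; first exact: segment_compact.
  by apply: continuous_subspaceT; exact: continuous_gauss_fun.
move: E; rewrite g00 !subr0 => ->; apply: ler_piMl; first exact: ltW.
by rewrite expR_le1 oppr_le0 sqr_ge0.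
Qed.

Lemma cvg_integral0_gauss :
  (@integral0_gauss R r @[r --> +oo%R] --> Num.sqrt pi / 2)%classic.
Proof.
have : (Num.sqrt (@integral0_gauss R r ^+ 2) @[r --> +oo%R]
    --> Num.sqrt (pi / 4))%classic.
  apply: continuous_cvg => //;
    [exact: sqrt_continuous|exact: cvg_integral0_gauss_sqr].
rewrite sqrtrM ?pi_ge0// sqrtrV// (_ : 4 = 2 ^+ 2 :> R); last by ring.
rewrite sqrtr_sqr ger0_norm//.
under eq_fun do rewrite sqrtr_sqr ger0_norm ?integral0_gauss_ge0//.
by [].
Qed.

Lemma onem_expRN_itv (u : R) : 0 <= u -> 0 <= 1 - expR (- u) <= Num.min 1 u.
Proof.
move=> u0; rewrite subr_ge0 expR_le1 oppr_le0 u0/= le_min; apply/andP; split.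
  by rewrite gerBl expR_ge0.
by have := expR_ge1Dx (- u); lra.
Qed.

Lemma is_derive_mixture_prim (r : R) : 0 < r ->
  is_derive r 1 mixture_prim ((1 - expR (- r ^+ 2)) / r ^+ 2).
Proof.
move=> r0; have r1 : r != 0 by rewrite gt_eqF.
have dI := is_derive_integral0_gauss r0.
have dE : is_derive r 1 (fun t => expR (- t ^+ 2)) (expR (- r ^+ 2) * (- (2 * r))).
  apply: (@is_derive1_comp _ expR (fun t => - t ^+ 2)).
  apply: is_deriveN; apply: is_derive_eq.
  by rewrite /GRing.scale/= !mulr1; ring.
have dV : is_derive r 1 (fun t : R => t^-1) (- r ^- 2).
  apply: is_derive_eq; first by apply: (@is_deriveV _ id r).
  by rewrite [LHS]mulr1.
rewrite (_ : mixture_prim = 2 \*: (@integral0_gauss R)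
   - (cst 1 - (fun t => expR (- t ^+ 2))) * (fun t => t^-1)); last first.
  by apply/funext.
apply: is_derive_eq.
rewrite /= !scaler_nat /GRing.scale/= !fctE/=; field.
exact: r1.
Qed.

Lemma norm_mixture_prim_le (r : R) : 0 < r -> `|mixture_prim r| <= 2 * r.
Proof.
move=> r0.
have := onem_expRN_itv (sqr_ge0 r); rewrite le_min => /andP[e0 /andP[_ e1]].
have a0 : 0 <= (1 - expR (- r ^+ 2)) / r by rewrite divr_ge0// ltW.
have a1 : (1 - expR (- r ^+ 2)) / r <= r.
  by rewrite ler_pdivrMr// -expr2.
have := integral0_gauss_ge0 r; have := integral0_gauss_le r0.
rewrite /mixture_prim ler_norml; move: (_ / _) a0 a1 (integral0_gauss r) => a *.
by apply/andP; split; lra.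
Qed.

Lemma cvg_mixture_prim : (mixture_prim r @[r --> +oo%R] --> Num.sqrt (pi : R))%classic.
Proof.
rewrite (_ : Num.sqrt (pi : R) = 2 * (Num.sqrt pi / 2) - 0); last by field.
apply: cvgB; first by apply: cvgM; [exact: cvg_cst|]; exact: cvg_integral0_gauss.
apply: (@squeeze_cvgr _ _ _ _ (cst 0) (fun r => r^-1)).
- near=> r.
  have r0 : 0 < r by near: r; exact: nbhs_pinfty_gt.
  have := onem_expRN_itv (sqr_ge0 r); rewrite le_min => /andP[e0 /andP[e1 _]].
  rewrite /= divr_ge0//= ?(ltW r0)//.
  by rewrite -[leRHS]mul1r ler_wpM2r// invr_ge0 ltW.
- exact: cvg_cst.
- apply/(gtr0_cvgV0 _).2 => //; exact: nbhs_pinfty_gt.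
Unshelve. all: end_near. Qed.

End norm_as_gaussian_mixture.

(** * Negative type of the Euclidean distance *)

Section negative_type.
Context {R : realType} {p : nat}.
Implicit Types (z : 'rV[R]_p) (s : R).

Definition dist_form (I : finType) (w : I -> R) (x : I -> 'rV[R]_p) : R :=
  - \sum_i \sum_j w i * w j * enorm (x i - x j).

(** For weights of total mass zero, the integral of [gauss_form w x r / r^2] over
    the scales [0 < r < s]; it tends to [sqrt pi * dist_form w x]. *)
Definition mixture_form (I : finType) (w : I -> R) (x : I -> 'rV[R]_p) s : R :=
  - \sum_i \sum_j w i * w j *
      (enorm (x i - x j) * mixture_prim (s * enorm (x i - x j))).

Lemma is_derive_mixture_primM (u s : R) : 0 <= u -> 0 < s ->
  is_derive s 1 (fun t => u * mixture_prim (t * u))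
    ((1 - expR (- (s * u) ^+ 2)) / s ^+ 2).
Proof.
move=> u0 s0; have s1 : s != 0 by rewrite gt_eqF.
have [->|u1] := eqVneq u 0.
  rewrite mulr0 expr0n oppr0 expR0 subrr mul0r.
  by under eq_fun do rewrite mul0r; exact: is_derive_cst.
have su0 : 0 < s * u by rewrite mulr_gt0// lt0r u1.
have dl : is_derive s 1 (fun t : R => t * u) u.
  apply: is_derive_eq; rewrite /GRing.scale/=; ring.
have dm : is_derive s 1 (fun t => mixture_prim (t * u))
    ((1 - expR (- (s * u) ^+ 2)) / (s * u) ^+ 2 * u).
  apply: (@is_derive1_comp _ mixture_prim (fun t => t * u)).
  exact: is_derive_mixture_prim.
rewrite (_ : (fun t => _) = u \*: (fun t => mixture_prim (t * u))); last first.
  by apply/funext.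
apply: is_derive_eq; rewrite /GRing.scale/=.
by field; rewrite s1 u1.
Qed.

Lemma is_derive_mixture_form (I : finType) (w : I -> R) (x : I -> 'rV[R]_p) s :
  \sum_i w i = 0 -> 0 < s ->
  is_derive s 1 (mixture_form w x) (gauss_form w x s / s ^+ 2).
Proof.
move=> w0 s0.
have -> : gauss_form w x s / s ^+ 2 = - \sum_i \sum_j w i * w j *
    ((1 - expR (- (s * enorm (x i - x j)) ^+ 2)) / s ^+ 2).
  (* The ones of the kernels [1 - gauss] cancel, the weights having mass zero. *)
  have E : \sum_i \sum_j w i * w j * (s ^- 2) = 0.
    transitivity ((\sum_i w i) * (\sum_j w j) * s ^- 2); last by rewrite w0 !mul0r.
    rewrite !mulr_suml; apply: eq_bigr => i _.
    by rewrite mulr_sumr mulr_suml.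
  rewrite -[RHS]addr0 -[X in _ = _ + X]E -sumrN -big_split/= /gauss_form mulr_suml.
  apply: eq_bigr => i _; rewrite -sumrN -big_split/= mulr_suml.
  by apply: eq_bigr => j _; rewrite gaussC /gauss; ring.
apply: is_deriveN.
apply: is_derive_finsum => i; apply: is_derive_finsum => j.
have := is_derive_mixture_primM (enorm_ge0 (x i - x j)) s0.
move=> d; apply: is_derive_eq.
by [].
Qed.

Lemma mixture_form_MVT (I : finType) (w : I -> R) (x : I -> 'rV[R]_p) r s :
  \sum_i w i = 0 -> 0 < r -> r < s ->
  exists2 c, r < c < s &
    mixture_form w x s - mixture_form w x r
    = gauss_form w x c / c ^+ 2 * (s - r).
Proof.
move=> w0 r0 rs.
have D t : r <= t -> is_derive t 1 (mixture_form w x) (gauss_form w x t / t ^+ 2).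
  by move=> rt; apply: is_derive_mixture_form => //; exact: lt_le_trans rt.
have [||c] := @MVT R (mixture_form w x) (fun t => gauss_form w x t / t ^+ 2) r s rs.
- by move=> t; rewrite in_itv/= => /andP[/ltW rt _]; exact: D.
- apply: derivable_within_continuous => t; rewrite in_itv/= => /andP[rt _].
  by have [] := D t rt.
by rewrite in_itv/=; exists c.
Qed.

Lemma mixture_form_homo (I : finType) (w : I -> R) (x : I -> 'rV[R]_p) r s :
  \sum_i w i = 0 -> 0 < r -> r <= s -> mixture_form w x r <= mixture_form w x s.
Proof.
move=> w0 r0; rewrite le_eqVlt => /predU1P[->//|rs].
have [c _ E] := mixture_form_MVT x w0 r0 rs.
by rewrite -subr_ge0 E mulr_ge0 ?subr_ge0 ?(ltW rs)// divr_ge0 ?sqr_ge0 ?gauss_form_ge0.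
Qed.

Lemma mixture_form_ge0 (I : finType) (w : I -> R) (x : I -> 'rV[R]_p) s :
  \sum_i w i = 0 -> 0 < s -> 0 <= mixture_form w x s.
Proof.
move=> w0 s0; apply/ler_addgt0Pr => e e0.
set C := \sum_i \sum_j `|w i * w j| * (enorm (x i - x j) ^+ 2 * 2).
have C0 : 0 <= C.
  by do 2!apply: sumr_ge0 => ? _; rewrite mulr_ge0// mulr_ge0// sqr_ge0.
pose r := Num.min s (e / (C + 1)).
have r0 : 0 < r by rewrite lt_min s0 divr_gt0// ltr_wpDl.
have Cr : C * r <= e.
  rewrite (@le_trans _ _ (C * (e / (C + 1))))//.
    by rewrite ler_wpM2l// ge_min lexx orbT.
  by rewrite mulrA ler_pdivrMr ?ltr_wpDl// mulrC ler_wpM2l ?lerDl// ltW.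
have rs : r <= s by rewrite ge_min lexx.
have := mixture_form_homo x w0 r0 rs.
suff : - (C * r) <= mixture_form w x r by lra.
rewrite lerN2 mulr_suml; apply: ler_sum => i _.
rewrite mulr_suml; apply: ler_sum => j _.
apply: le_trans (ler_norm _) _; rewrite normrM -mulrA ler_wpM2l//.
rewrite normrM ger0_norm ?enorm_ge0//.
have := enorm_ge0 (x i - x j); rewrite le_eqVlt => /predU1P[<-|u0].
  by rewrite mul0r expr0n !mul0r.
rewrite expr2 -!mulrA ler_pM2l//.
apply: le_trans (norm_mixture_prim_le _) _; first by rewrite mulr_gt0.
by rewrite mulrA mulrC.
Qed.

Lemma mixture_form_le (I : finType) (w : I -> R) (x : I -> 'rV[R]_p) s :
  \sum_i w i = 0 -> 0 < s -> mixture_form w x s <= Num.sqrt pi * dist_form w x.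
Proof.
move=> w0 s0.
have cvgQ : (mixture_form w x t @[t --> +oo%R] -->
    Num.sqrt pi * dist_form w x)%classic.
  rewrite /mixture_form /dist_form mulrN; apply: cvgN.
  rewrite mulr_sumr; apply: cvg_finsum => i.
  rewrite mulr_sumr; apply: cvg_finsum => j.
  rewrite mulrCA; apply: cvgM; first exact: cvg_cst.
  have := enorm_ge0 (x i - x j); rewrite le_eqVlt => /predU1P[<-|u0].
    by under eq_fun do rewrite mul0r; rewrite mulr0; exact: cvg_cst.
  rewrite mulrC; apply: cvgM; first exact: cvg_cst.
  apply: (cvg_comp (fun t => t * enorm (x i - x j)) mixture_prim); last first.
    exact: cvg_mixture_prim.
  exact: gt0_cvgMly.
rewrite -(cvg_lim _ cvgQ)//; apply: limr_ge; first by apply/cvg_ex; eexists; exact: cvgQ.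
near=> t; exact: mixture_form_homo.
Unshelve. all: by end_near. Qed.

(** Up to the factor [sqrt pi], the form is the limit at infinity of
    [mixture_form w x], an integral of nonnegative Gaussian forms. *)
Lemma dist_form_ge0 (I : finType) (w : I -> R) (x : I -> 'rV[R]_p) :
  \sum_i w i = 0 -> 0 <= dist_form w x.
Proof.
move=> w0; have := mixture_form_le x w0 (@ltr01 R).
have pi0 : 0 < Num.sqrt pi :> R by rewrite sqrtr_gt0 pi_gt0.
by move=> /(le_trans (mixture_form_ge0 x w0 ltr01)); rewrite pmulr_rge0.
Qed.

Lemma gauss_lipschitz s c z y : 0 < s -> s <= c ->
  `|gauss c z y - gauss s z y| <= (c ^+ 2 - s ^+ 2) / s ^+ 2.
Proof.
move=> s0 sc; rewrite /gauss !exprMn; set v := enorm _ ^+ 2.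
have v0 : 0 <= v by exact: sqr_ge0.
have sc2 : 0 <= c ^+ 2 - s ^+ 2.
  by rewrite subr_ge0 ler_sqr ?nnegrE// ltW// (lt_le_trans s0).
have -> : - (c ^+ 2 * v) = - (s ^+ 2 * v) - ((c ^+ 2 - s ^+ 2) * v) by ring.
rewrite expRD; set E := expR (- (s ^+ 2 * v)).
have E0 : 0 < E by exact: expR_gt0.
have := onem_expRN_itv (mulr_ge0 sc2 v0); rewrite le_min => /andP[F0 /andP[_ F1]].
rewrite -[X in _ - X]mulr1 -mulrBr normrM gtr0_norm// distrC ger0_norm//.
rewrite ler_pdivlMr ?exprn_gt0//.
apply: (@le_trans _ _ ((c ^+ 2 - s ^+ 2) * (E * (s ^+ 2 * v)))).
  rewrite [leRHS](_ : _ = E * ((c ^+ 2 - s ^+ 2) * v) * s ^+ 2); last by ring.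
  by rewrite ler_wpM2r ?sqr_ge0// ler_pM2l.
rewrite -[leRHS]mulr1 ler_wpM2l// /E expRN ler_pdivrMl ?expR_gt0// mulr1.
by have := expR_ge1Dx (s ^+ 2 * v); lra.
Qed.

(** Gaussian test functions are controlled by the distance form: at scales
    slightly above [s] the Gaussian sum stays above half of its value at [s],
    and this whole range of scales enters the mixture. *)
Lemma gauss_sum_cube_le (I : finType) (w : I -> R) (x : I -> 'rV[R]_p) s z :
  \sum_i w i = 0 -> \sum_i `|w i| <= 2 -> 0 < s ->
  `|\sum_i w i * gauss s z (x i)| ^+ 3 <= 192 * s * (Num.sqrt pi * dist_form w x).
Proof.
move=> w0 w2 s0.
have pD0 : 0 <= Num.sqrt pi * dist_form w x.
  by rewrite mulr_ge0 ?sqrtr_ge0 ?dist_form_ge0.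
set q := fun s => \sum_i w i * gauss s z (x i).
rewrite -/(q s); have := normr_ge0 (q s); rewrite le_eqVlt => /predU1P[<-|q0].
  by rewrite expr0n; apply: mulr_ge0 pD0; apply: mulr_ge0 (ltW s0).
have q2 : `|q s| <= 2.
  apply: le_trans (ler_norm_sum _ _ _) _; apply: le_trans w2.
  apply: ler_sum => i _; rewrite normrM ler_piMr// ger0_norm ?gauss_le1//.
  exact: gauss_ge0.
(* With this [d], the sums at the scales from [s] to [s * (1 + d)] differ from
   [q s] by at most [6 * d], half of its absolute value. *)
set u := `|q s| in q0 q2 *; pose d := u / 12.
have d0 : 0 < d by rewrite divr_gt0.
have d6 : d <= 1 / 6 by rewrite /d; lra.
have ss1 : s < s * (1 + d) by rewrite ltr_pMr// ltrDl.
have [c /andP[sc cs] E] := mixture_form_MVT x w0 s0 ss1.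
have s10 : 0 < s * (1 + d) by exact: lt_trans ss1.
have := mixture_form_le x w0 s10; have := mixture_form_ge0 x w0 s0.
move=> Q0 Q1.
have EQ : gauss_form w x c / c ^+ 2 * (s * d) <= Num.sqrt pi * dist_form w x.
  have -> : s * d = s * (1 + d) - s by ring.
  by rewrite -E; lra.
have c0 : 0 < c by exact: lt_trans sc.
have qc : `|q c - q s| <= u / 2.
  rewrite /q -sumrB; apply: le_trans (ler_norm_sum _ _ _) _.
  apply: (@le_trans _ _ (\sum_i `|w i| * (3 * d))).
    apply: ler_sum => i _; rewrite -mulrBr normrM ler_wpM2l//.
    apply: le_trans (gauss_lipschitz _ _ s0 (ltW sc)) _.
    rewrite ler_pdivrMr ?exprn_gt0//.
    have : c ^+ 2 <= (s * (1 + d)) ^+ 2 by rewrite ler_sqr ?nnegrE ltW.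
    have : 0 < s ^+ 2 by rewrite exprn_gt0.
    rewrite exprMn; move: (s ^+ 2) (c ^+ 2) => S C S0 CS.
    have : 0 <= S * (d * (1 - d)) by rewrite !mulr_ge0 ?(ltW S0) ?(ltW d0)//; lra.
    by lra.
  by rewrite -mulr_suml; rewrite /d; nra.
have qc2 : u ^+ 2 / 4 <= gauss_form w x c.
  apply: le_trans (sqr_gauss_sum_le w x c z); rewrite -/(q c).
  have : u / 2 <= `|q c| 
    by have := lerB_dist (q s) (q c); rewrite (distrC (q s)) -/u; lra.
  rewrite -(@real_normK _ (q c)) ?num_real//; nra.
have cd : c ^+ 2 <= 4 * s ^+ 2.
  rewrite (_ : 4 * _ = (2 * s) ^+ 2); last by ring.
  by rewrite ler_sqr ?nnegrE ?mulr_ge0// ?ltW//; apply: lt_le_trans cs _; nra.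
have c2 : 0 < c ^+ 2 by rewrite exprn_gt0.
rewrite -ler_pdivrMl ?mulr_gt0//; apply: le_trans EQ.
rewrite mulrAC ler_pdivlMr//.
apply: (@le_trans _ _ (u ^+ 2 / 4 * (s * d))); last first.
  by rewrite ler_wpM2r// mulr_ge0// ltW.
apply: (@le_trans _ _ ((192 * s)^-1 * u ^+ 3 * (4 * s ^+ 2))).
  by rewrite ler_wpM2l// mulr_ge0 ?invr_ge0 ?mulr_ge0 ?exprn_ge0 ?ltW.
rewrite le_eqVlt; apply/orP; left; apply/eqP; rewrite /d; field.
by rewrite gt_eqF.
Qed.

End negative_type.

(** * Means and derandomized samples *)

Section means.
Context {d : measure_display} {T : measurableType d} {R : realType}.
Context (P : probability T R).
Implicit Types (u v : T -> R) (a b c : R).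

Definition mean_is u c : Prop :=
  P.-integrable setT (EFin \o u) /\ (\int[P]_y (u y)%:E = c%:E)%E.

Lemma mean_is_ext u v c : u =1 v -> mean_is u c -> mean_is v c.
Proof. by move=> /funext->. Qed.

Lemma mean_is_uniq u a b : mean_is u a -> mean_is u b -> a = b.
Proof. by move=> [_ ua] [_]; rewrite ua => -[]. Qed.

Lemma mean_is_cst a : mean_is (fun=> a) a.
Proof.
split; first exact: finite_measure_integrable_cst.
by rewrite integral_cst//= probability_setT mule1.
Qed.

Lemma mean_isD u v a b :
  mean_is u a -> mean_is v b -> mean_is (fun y => u y + v y) (a + b).
Proof.
move=> [iu ua] [iv vb]; split; first exact: (integrableD measurableT iu iv).
by have := integralD_EFin measurableT iu iv; rewrite /= ua vb.
Qed.

Lemma mean_isZ k u a : mean_is u a -> mean_is (fun y => k * u y) (k * a).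
Proof.
move=> [iu ua]; split; first exact: (integrableZl measurableT k iu).
by have := integralZl measurableT iu k; rewrite /= ua.
Qed.

Lemma mean_isB u v a b :
  mean_is u a -> mean_is v b -> mean_is (fun y => u y - v y) (a - b).
Proof.
move=> ua /(mean_isZ (-1)) vb; rewrite -[- b]mulN1r.
by apply: mean_is_ext (mean_isD ua vb) => y; rewrite mulN1r.
Qed.

Lemma mean_is_sum (I : finType) (u : I -> T -> R) (c : I -> R) :
  (forall i, mean_is (u i) (c i)) ->
  mean_is (fun y => \sum_i u i y) (\sum_i c i).
Proof.
move=> uc; elim: (index_enum I) => [|i s IH].
  by rewrite big_nil; under [fun y => _]eq_fun do rewrite big_nil; exact: mean_is_cst.
rewrite big_cons; under [fun y => _]eq_fun do rewrite big_cons.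
exact: mean_isD.
Qed.

Lemma mean_is_le u v a b :
  (forall y, u y <= v y) -> mean_is u a -> mean_is v b -> a <= b.
Proof.
move=> uv [iu ua] [iv vb]; rewrite -lee_fin -ua -vb.
by apply: le_integral => // y _; rewrite lee_fin.
Qed.

Lemma mean_is_bounded u : measurable_fun setT u ->
  (forall y, 0 <= u y <= 1) -> exists2 c, 0 <= c <= 1 & mean_is u c.
Proof.
move=> mu u01.
have iu : P.-integrable setT (EFin \o u).
  apply: measurable_bounded_integrable => //.
    by rewrite [X in (X < _)%E](probability_setT P) ltry.
  exists 1; split => // M M1 y _; have /andP[u0 u1] := u01 y.
  by rewrite /= ger0_norm// (le_trans u1)// ltW.
have muc : mean_is u (fine (\int[P]_y (u y)%:E)).
  by split=> //; rewrite fineK//; exact: integrable_fin_num.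
exists (fine (\int[P]_y (u y)%:E)) => //; apply/andP; split.
  by apply: mean_is_le (mean_is_cst 0) muc => y; have /andP[] := u01 y.
by apply: mean_is_le muc (mean_is_cst 1) => y; have /andP[] := u01 y.
Qed.

(** A function exceeding its mean almost surely would have a positive centred
    version of mean zero. *)
Lemma exists_le_mean (X : set T) u c :
  {ae P, forall y, X y} -> mean_is u c -> exists2 y, X y & u y <= c.
Proof.
move=> PX uc; apply: contrapT => nle.
have gt y : X y -> c < u y.
  by move=> Xy; rewrite ltNge; apply/negP => le; apply: nle; exists y.
have [iv v0] := mean_isB uc (mean_is_cst c).
have mv := measurable_int _ iv.
have v_eq0 : ae_eq P setT (EFin \o (fun y => u y - c)) (cst 0%E).
  apply/(ae_eq_integral_abs P measurableT mv).
  rewrite -[RHS]/(0%:E) -(subrr c) -v0.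
  apply: (ae_eq_integral (EFin \o (fun y => u y - c))) => //.
    exact: measurable_int (integrable_abse iv).
  apply: filterS PX => y /gt cu _ /=; rewrite gtr0_norm// subr_gt0//.
have PT : (0%R < P setT)%E by rewrite [X in (_ < X)%E](probability_setT P).
have PF := ae_properfilter_algebraOfSetsType PT.
have [] := filter_ex (filterI PX v_eq0).
move=> y [/gt cu /(_ I)/=[]] /eqP; rewrite subr_eq0 => /eqP E.
by rewrite E ltxx in cu.
Qed.

(** The expected value of the left-hand side for an i.i.d. sample is the
    right-hand side; choosing the points one after the other, each no worse than
    average, derandomizes the sample.  The function [h] carries the interaction
    with the points already chosen. *)
Lemma exists_sample_le (X : set T) (k : T -> T -> R) (m : T -> R) (mm dd : R) :
  {ae P, forall y, X y} ->
  (forall y y', k y y' = k y' y) -> (forall y, mean_is (k y) (m y)) ->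
  mean_is m mm -> mean_is (fun y => k y y) dd ->
  forall (n : nat) (h : T -> R) (hh : R), mean_is h hh ->
  exists2 y : 'I_n -> T, (forall i, X (y i)) &
    \sum_i \sum_j k (y i) (y j) + \sum_i h (y i)
    <= n%:R * (n%:R - 1) * mm + n%:R * dd + n%:R * hh.
Proof.
move=> PX ksym km mmm kd; elim=> [|n IH] h hh hm.
  have [y0 Xy0 _] := exists_le_mean PX hm.
  by exists (fun=> y0) => //; rewrite !big_ord0 !mul0r !addr0.
(* [2 * n * m z] is the expected interaction of [z] with the [n] points still to
   be chosen. *)
have [z Xz zle] := exists_le_mean PX
  (mean_isD (mean_isD (mean_isZ (2 * n%:R) mmm) kd) hm).
have [y Xy yle] := IH _ _ (mean_isD hm (mean_isZ 2 (km z))).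
pose y' (i : 'I_n.+1) := if unlift ord0 i is Some j then y j else z.
have y'0 : y' ord0 = z by rewrite /y' unlift_none.
have y'S j : y' (lift ord0 j) = y j by rewrite /y' liftK.
exists y'; first by move=> i; rewrite /y'; case: unlift.
rewrite !big_ord_recl y'0; under eq_bigr do rewrite y'S.
under [X in _ + X + _]eq_bigr do (rewrite big_ord_recl y'0 y'S;
  under eq_bigr do rewrite y'S).
under [X in _ + (_ + X)]eq_bigr do rewrite y'S.
rewrite big_split/=; under [X in _ + (X + _) + _]eq_bigr do rewrite ksym.
move: yle; rewrite big_split/= -mulr_sumr => yle.
have -> : n.+1%:R = n%:R + 1 :> R by rewrite natr1.
move: (\sum_i k z (y i)) (\sum_i \sum_j k (y i) (y j)) (\sum_i h (y i)) yle zle => A B C.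
move: (n%:R) (m z) (k z z) (h z) => N mz kz hz; lra.
Qed.

End means.

(** * Mean distances *)

Section mean_distances.
Context {R : realType} {p : nat}.
Implicit Types (x y z : 'rV[R]_p).

Lemma measurable_coord (j : 'I_p) :
  measurable_fun setT (fun y : 'rV[R]_p => y 0 j).
Proof.
apply: (measurability _ (RGenOpens.measurableE R)).
move=> _ [_ [a [b ->]] <-]; rewrite setTI; apply: sub_sigma_algebra.
apply: open_comp; last exact: interval_open.
by move=> y _; exact: coord_continuous.
Qed.

Lemma measurable_enorm {d : measure_display} {T : measurableType d}
    (v : T -> 'rV[R]_p) :
  (forall j, measurable_fun setT (fun t => v t 0 j)) ->
  measurable_fun setT (fun t => enorm (v t)).
Proof.
move=> mv.
rewrite (_ : (fun t => _) = Num.sqrt \o (fun t => \sum_j v t 0 j ^+ 2))//.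
apply: measurableT_comp.
  by apply: continuous_measurable_fun; exact: sqrt_continuous.
apply: measurable_sum => j; under eq_fun do rewrite expr2.
exact: measurable_funM.
Qed.

Lemma measurable_dist x : measurable_fun setT (fun y => enorm (x - y)).
Proof.
apply: measurable_enorm => j; under eq_fun do rewrite !mxE.
by apply: measurable_funB => //; exact: measurable_coord.
Qed.

Lemma measurable_gauss s z : measurable_fun setT (gauss s z).
Proof.
rewrite (_ : gauss s z = expR \o (fun y => - ((s * enorm (z - y)) * (s * enorm (z - y))))).
  apply: measurableT_comp => //; apply: measurableT_comp => //.
  by apply: measurable_funM; apply: measurable_funM => //; exact: measurable_dist.
by apply/funext => y; rewrite /gauss/= enormC expr2.
Qed.

Lemma le_coord_enorm y (j : 'I_p) : `|y 0 j| <= enorm y.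
Proof.
rewrite -sqrtr_sqr ler_sqrt ?sumr_ge0// => [|i _]; last exact: sqr_ge0.
by rewrite (bigD1 j)//= lerDl sumr_ge0// => i _; exact: sqr_ge0.
Qed.

Lemma dot_le x y : dot x y <= enorm x * enorm y.
Proof.
have nul0 z z' : enorm z = 0 -> dot z z' = 0.
  move=> z0; apply: big1 => j _; have := le_coord_enorm z j.
  by rewrite z0 normr_le0 => /eqP->; rewrite mul0r.
have := enorm_ge0 x; rewrite le_eqVlt => /predU1P[/esym x0|x0].
  by rewrite nul0// x0 mul0r.
have := enorm_ge0 y; rewrite le_eqVlt => /predU1P[/esym y0|y0].
  rewrite (_ : dot x y = dot y x); first by rewrite nul0// y0 mulr0.
  by apply: eq_bigr => j _; rewrite mulrC.
have := sqr_ge0 (enorm (enorm y *: x - enorm x *: y)).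
have -> : enorm (enorm y *: x - enorm x *: y) ^+ 2
    = 2 * (enorm x * enorm y) * (enorm x * enorm y - dot x y).
  transitivity (enorm y ^+ 2 * dot x x + enorm x ^+ 2 * dot y y
      - 2 * (enorm x * enorm y) * dot x y); last by rewrite -!sqr_enorm; ring.
  rewrite sqr_enorm /dot !mulr_sumr -big_split/= -sumrB.
  by apply: eq_bigr => j _; rewrite !mxE; ring.
by rewrite pmulr_rge0 ?subr_ge0// !mulr_gt0.
Qed.

Lemma enormB_le x y z : enorm (x - y) <= enorm (x - z) + enorm (z - y).
Proof.
rewrite -ler_sqr ?nnegrE ?addr_ge0 ?enorm_ge0// sqrrD.
rewrite (_ : enorm (x - y) ^+ 2 = enorm (x - z) ^+ 2 + enorm (z - y) ^+ 2
    + dot (x - z) (z - y) *+ 2).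
  by rewrite [leRHS]addrAC lerD2l lerMn2r dot_le orbT.
rewrite !sqr_enorm /dot -sumrMnl -!big_split/=.
by apply: eq_bigr => j _; rewrite !mxE mulr2n; ring.
Qed.

Context (P : probability 'rV[R]_p R) (X : set 'rV[R]_p).
Context (PX : {ae P, forall y, X y}) (Efin : finite_energy P X).

Lemma mean_dist_toE x : mean_dist_to P x = (\int[P]_y (enorm (x - y))%:E)%E.
Proof. by rewrite /mean_dist_to unlock. Qed.

(** Finiteness at one point of [X] gives finiteness everywhere, by the triangle
    inequality. *)
Lemma mean_is_dist x :
  mean_is P (fun y => enorm (x - y)) (fine (mean_dist_to P x)).
Proof.
have [z Xz _] := exists_le_mean PX (mean_is_cst P 0).
have iz : P.-integrable setT (EFin \o (fun y => enorm (z - y))).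
  apply/integrableP; split.
    by apply/measurable_EFinP; exact: measurable_dist.
  have := Efin.1 z Xz; rewrite mean_dist_toE.
  by under eq_integral do rewrite -[X in X%:E]ger0_norm ?enorm_ge0//.
have ix : P.-integrable setT (EFin \o (fun y => enorm (x - y))).
  have ib : P.-integrable setT
      (EFin \o (fun y => enorm (x - z) + enorm (z - y))).
    have i1 := finite_measure_integrable_cst P (enorm (x - z)) measurableT.
    exact: (integrableD measurableT i1 iz).
  apply: le_integrable ib => //.
    by apply/measurable_EFinP; exact: measurable_dist.
  move=> y _; rewrite /= lee_fin ger0_norm ?enorm_ge0//.
  by rewrite (le_trans (enormB_le x y z))// ler_norm.
split=> //; rewrite mean_dist_toE fineK//.
exact: (integrable_fin_num measurableT ix).
Qed.

Lemma mean_is_mean_dist :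
  mean_is P (fun x => fine (mean_dist_to P x)) (fine (mean_dist P)).
Proof.
pose g (t : 'rV[R]_p * 'rV[R]_p) := (enorm (t.1 - t.2))%:E.
have mg : measurable_fun setT g.
  apply/measurable_EFinP; apply: measurable_enorm => j.
  under eq_fun do rewrite !mxE.
  apply: measurable_funB.
    exact: (measurableT_comp (measurable_coord j) measurable_fst).
  exact: (measurableT_comp (measurable_coord j) measurable_snd).
have g0 t : (0 <= g t)%E by rewrite lee_fin enorm_ge0.
have FE : fubini_F P g = EFin \o (fun x => fine (mean_dist_to P x)).
  by apply/funext => x /=; rewrite -(mean_is_dist x).2.
have mF := measurable_fun_fubini_tonelli_F (m2 := P) g mg g0.
have E : (\int[P]_x (fine (mean_dist_to P x))%:E)%E = mean_dist P.
  have := fubini_tonelli1 (m1 := P) (m2 := P) g mg g0.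
  by rewrite FE /mean_dist unlock => <-.
have i : P.-integrable setT (EFin \o (fun x => fine (mean_dist_to P x))).
  apply/integrableP; split; first by rewrite -FE.
  have := Efin.2; rewrite -E; congr (_ < _)%E; apply: eq_integral => x _ /=.
  rewrite ger0_norm// fine_ge0// mean_dist_toE integral_ge0// => y _.
  by rewrite lee_fin enorm_ge0.
split=> //; rewrite E fineK// -E.
exact: (integrable_fin_num measurableT i).
Qed.

End mean_distances.

(** * Weighted energies and empirical substitutes *)

Section weighted_energy.
Context {R : realType} {p : nat}.
Context (P : probability 'rV[R]_p R) (X : set 'rV[R]_p).

(** The energy distance to [P] of a family with real weights of sum one; weights
    of both signs are allowed because the energy is used as a quadratic form. *)
Definition wenergy (I : finType) (w : I -> R) (x : I -> 'rV[R]_p) : R :=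
  2 * (\sum_i w i * fine (mean_dist_to P (x i)))
  - (\sum_i \sum_j w i * w j * enorm (x i - x j)) - fine (mean_dist P).

Definition unif (I : finType) (A : {set I}) (i : I) : R :=
  (i \in A)%:R / #|A|%:R.

Lemma sum_ord_const (n : nat) (a : R) : \sum_(i < n) a = n%:R * a.
Proof. by rewrite sumr_const card_ord mulr_natl. Qed.

Lemma sum_unif (I : finType) (A : {set I}) (F : I -> R) :
  \sum_i unif A i * F i = #|A|%:R^-1 * \sum_(i in A) F i.
Proof.
rewrite mulr_sumr [RHS]big_mkcond/=; apply: eq_bigr => i _; rewrite /unif.
by case: (i \in A); rewrite ?mul1r// !mul0r.
Qed.

Lemma unif_sum1 (I : finType) (A : {set I}) :
  (0 < #|A|)%N -> \sum_i unif A i = 1.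
Proof.
move=> A0; under eq_bigr do rewrite -[unif A _]mulr1.
by rewrite sum_unif sumr_const mulVf// pnatr_eq0 -lt0n.
Qed.

Lemma unif_ge0 (I : finType) (A : {set I}) i : 0 <= unif A i.
Proof. by rewrite /unif divr_ge0. Qed.

Lemma energyE (I : finType) (x : I -> 'rV[R]_p) (A : {set I}) :
  energy P x A = wenergy (unif A) x.
Proof.
rewrite /wenergy sum_unif; under [X in _ - X - _]eq_bigr do
  (under eq_bigr do rewrite -mulrA; rewrite -mulr_sumr sum_unif).
by rewrite sum_unif -mulr_sumr /energy expr2 invfM; ring.
Qed.

Context (PX : {ae P, forall y, X y}) (Efin : finite_energy P X).

Local Notation f := (fun x => fine (mean_dist_to P x)).
Local Notation mu := (fine (mean_dist P)).
Let mean_f x : mean_is P (fun y => enorm (x - y)) (f x).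
Proof. exact: mean_is_dist PX Efin x. Qed.
Let mean_mu : mean_is P f mu.
Proof. exact: mean_is_mean_dist PX Efin. Qed.

Lemma mean_dist_to_ge0 x : 0 <= f x.
Proof. by apply: mean_is_le (mean_is_cst P 0) (mean_f x) => y; exact: enorm_ge0. Qed.

Lemma mean_dist_ge0 : 0 <= mu.
Proof. by apply: mean_is_le (mean_is_cst P 0) mean_mu => y; exact: mean_dist_to_ge0. Qed.

(** An i.i.d. sample of size [n] has expected energy [mu / n]. *)
Lemma exists_energy_le n : (0 < n)%N ->
  exists2 y : 'I_n -> 'rV[R]_p, (forall i, X (y i)) &
    energy P y [set: 'I_n] <= mu / n%:R.
Proof.
move=> n0; have n0' : n%:R != 0 :> R by rewrite pnatr_eq0 -lt0n.
(* The centred kernel: its sum over the points is [n^2] times the energy. *)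
pose k y y' := f y + f y' - enorm (y - y') - mu.
have ksym y y' : k y y' = k y' y by rewrite /k enormC; ring.
have km y : mean_is P (k y) 0.
  rewrite (_ : 0 = f y + mu - f y - mu); last by ring.
  apply: mean_isB (mean_is_cst P mu); apply: mean_isB (mean_f y).
  exact: mean_isD (mean_is_cst P (f y)) mean_mu.
have kd : mean_is P (fun y => k y y) mu.
  rewrite (_ : mu = mu + mu - 0 - mu); last by ring.
  apply: mean_isB (mean_is_cst P mu); apply: mean_isB; first exact: mean_isD.
  by under eq_fun do rewrite enormxx; exact: mean_is_cst.
have [y Xy yle] := exists_sample_le PX ksym km (mean_is_cst P 0) kd n (mean_is_cst P 0).
exists y => //; move: yle.
have -> : \sum_i \sum_j k (y i) (y j) = n%:R ^+ 2 * energy P y [set: 'I_n].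
  have sT (F : 'I_n -> R) : \sum_(i in [set: 'I_n]) F i = \sum_i F i.
    by apply: eq_bigl => i; rewrite inE.
  rewrite /energy !sT cardsT card_ord.
  under [X in _ - _ * X - _]eq_bigr do rewrite sT.
  transitivity (\sum_i (n%:R * f (y i) + \sum_j f (y j)
     - \sum_j enorm (y i - y j) - n%:R * mu)).
    apply: eq_bigr => i _; rewrite !sumrB big_split/=.
    by rewrite !sum_ord_const.
  rewrite !sumrB big_split/= -mulr_sumr !sum_ord_const.
  move: (\sum_i fine _) (\sum_i \sum_j _) (fine _) => F D M.
  by field.
rewrite big1// mulr0 add0r mulr0 addr0 addr0 ler_pdivlMr ?ltr0n// => H.
have n1 : 0 < n%:R :> R by rewrite ltr0n.
by rewrite -(ler_pM2l n1) mulrCA -expr2 [leLHS]mulrC.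
Qed.

(** An empirical substitute for the law: for an i.i.d. sample [y] the mean of the
    left-hand side is at most the right-hand side, the sampling error being
    [mu / n] for the energy and [v / n] for the test function.  Since the first
    term is nonnegative, the sample serves the energy and the test function at
    the same time. *)
Lemma exists_empirical (I : finType) (w : I -> R) (x : I -> 'rV[R]_p)
    (phi : 'rV[R]_p -> R) (c v : R) (n : nat) :
  \sum_i w i = 1 -> mean_is P phi c -> mean_is P (fun y => (phi y - c) ^+ 2) v ->
  (0 < n)%N ->
  exists y : 'I_n -> 'rV[R]_p,
    dist_form (fun i : I + 'I_n => if i is inl i then w i else - n%:R^-1)
      (fun i : I + 'I_n => match i with inl i => x i | inr j => y j end)
    + (n%:R^-1 * \sum_j phi (y j) - c) ^+ 2
    <= wenergy w x + (mu + v) / n%:R.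
Proof.
move=> w1 phic phiv n0; have n0' : n%:R != 0 :> R by rewrite pnatr_eq0 -lt0n.
pose G y := \sum_i w i * enorm (x i - y).
pose c0 := \sum_i \sum_j w i * w j * enorm (x i - x j).
pose a := \sum_i w i * f (x i).
have mG : mean_is P G a by apply: mean_is_sum => i; exact: mean_isZ.
pose k y y' := G y + G y' - enorm (y - y') - c0 + (phi y - c) * (phi y' - c).
have ksym y y' : k y y' = k y' y by rewrite /k enormC; ring.
have m0 : mean_is P (fun y => phi y - c) 0.
  by rewrite -(subrr c); apply: mean_isB (mean_is_cst P c).
have km y : mean_is P (k y) (G y + a - f y - c0 + (phi y - c) * 0).
  apply: mean_isD; last exact: mean_isZ.
  apply: mean_isB (mean_is_cst P c0); apply: mean_isB (mean_f y).
  exact: mean_isD (mean_is_cst P (G y)) mG.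
have kmm : mean_is P (fun y => G y + a - f y - c0 + (phi y - c) * 0)
    (wenergy w x).
  under eq_fun do rewrite mulr0 addr0.
  rewrite (_ : wenergy w x = a + a - mu - c0); last by rewrite /wenergy -/c0 -/a; ring.
  apply: mean_isB (mean_is_cst P c0); apply: mean_isB mean_mu.
  exact: mean_isD mG (mean_is_cst P a).
have kd : mean_is P (fun y => k y y) (wenergy w x + mu + v).
  rewrite (_ : wenergy w x + mu = a + a - 0 - c0); last first.
    by rewrite /wenergy -/c0 -/a; ring.
  apply: mean_isD; last by under eq_fun do rewrite -expr2.
  apply: mean_isB (mean_is_cst P c0); apply: mean_isB; first exact: mean_isD.
  by under eq_fun do rewrite enormxx; exact: mean_is_cst.
have [y _ yle] := exists_sample_le PX ksym km kmm kd n (mean_is_cst P 0).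
exists y; move: yle; rewrite [X in _ + X]big1// !addr0 mulr0 addr0 => yle.
have n1 : 0 < n%:R ^+ 2 :> R by rewrite exprn_gt0// ltr0n.
rewrite -(ler_pM2l n1); apply: le_trans (le_trans _ yle) _; last first.
  rewrite le_eqVlt; apply/orP; left; apply/eqP; move: (wenergy w x) mu => E M; by field.
rewrite le_eqVlt; apply/orP; left; apply/eqP.
have -> : \sum_i \sum_j k (y i) (y j) = 2 * n%:R * (\sum_j G (y j))
   - \sum_i \sum_j enorm (y i - y j) - n%:R ^+ 2 * c0
   + (\sum_j phi (y j) - n%:R * c) ^+ 2.
  transitivity (\sum_i (n%:R * G (y i) + \sum_j G (y j)
     - \sum_j enorm (y i - y j) - n%:R * c0
     + (phi (y i) - c) * \sum_j (phi (y j) - c))).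
    apply: eq_bigr => i _; rewrite big_split/= !sumrB big_split/= -mulr_sumr sumrB.
    by rewrite !sum_ord_const.
  rewrite big_split/= -mulr_suml !sumrB big_split/= -mulr_sumr !sum_ord_const.
  move: (\sum_i G (y i)) (\sum_i \sum_j enorm (y i - y j)) (\sum_i phi (y i)) => A B C.
  by ring.
rewrite /dist_form big_sumType/=.
under eq_bigr do rewrite big_sumType/=.
under [X in - (_ + X)]eq_bigr do rewrite big_sumType/=.
rewrite !big_split/= -/c0.
have -> : \sum_i \sum_j w i * - n%:R^-1 * enorm (x i - y j)
   = - n%:R^-1 * \sum_j G (y j).
  rewrite exchange_big mulr_sumr; apply: eq_bigr => j _.
  by rewrite mulr_sumr; apply: eq_bigr => i _; ring.
have -> : \sum_j \sum_i - n%:R^-1 * w i * enorm (y j - x i)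
   = - n%:R^-1 * \sum_j G (y j).
  rewrite mulr_sumr; apply: eq_bigr => j _.
  by rewrite mulr_sumr; apply: eq_bigr => i _; rewrite enormC; ring.
have -> : \sum_i \sum_j - n%:R^-1 * - n%:R^-1 * enorm (y i - y j)
   = n%:R ^- 2 * \sum_i \sum_j enorm (y i - y j).
  rewrite mulr_sumr; apply: eq_bigr => i _.
  by rewrite mulr_sumr; apply: eq_bigr => j _; field; exact: n0'.
move: (\sum_j G (y j)) (\sum_i \sum_j enorm (y i - y j)) (\sum_j phi (y j)) => A B C.
by field.
Qed.

Lemma natV_small (b e : R) : 0 < e -> exists2 n, (0 < n)%N & b / n%:R <= e.
Proof.
move=> e0; exists (Num.trunc (`|b| / e)).+1 => //.
rewrite ler_pdivrMr ?ltr0n//; apply: le_trans (ler_norm b) _.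
rewrite mulrC -ler_pdivrMr//; apply: ltW.
by have /andP[] := truncn_itv (divr_ge0 (normr_ge0 b) (ltW e0)).
Qed.

Lemma sum_signed_weights (I : finType) (w : I -> R) (n : nat) :
  \sum_i w i = 1 -> (0 < n)%N ->
  \sum_(i : I + 'I_n) (if i is inl i then w i else - n%:R^-1) = 0.
Proof.
move=> w1 n0; rewrite big_sumType/= w1 sum_ord_const.
by rewrite mulrN divff ?subrr// pnatr_eq0 -lt0n.
Qed.

(** The negative type of finite families passes to [P] because the sampling error
    tends to zero. *)
Lemma wenergy_ge0 (I : finType) (w : I -> R) (x : I -> 'rV[R]_p) :
  \sum_i w i = 1 -> 0 <= wenergy w x.
Proof.
move=> w1; apply/ler_addgt0Pr => e e0.
have [n n0 nle] := natV_small mu e0.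
have m0 : mean_is P (fun=> (0 - 0) ^+ 2) (0 : R).
  by rewrite subr0 expr0n; exact: mean_is_cst.
have [y] := exists_empirical x w1 (mean_is_cst P 0) m0 n0.
have := dist_form_ge0 (fun i : I + 'I_n => match i with inl i => x i | inr j => y j end)
  (sum_signed_weights w1 n0).
set D := dist_form _ _; rewrite addr0 => D0 H.
have := sqr_ge0 (n%:R^-1 * \sum_(j < n) 0 - 0 : R); lra.
Qed.

(** Uniformity over all finite weighted families replaces sequences of point sets
    here: it makes stability under linear combinations immediate. *)
Definition energy_controls (phi : 'rV[R]_p -> R) : Prop :=
  exists2 c, mean_is P phi c & forall e, 0 < e -> exists2 h, 0 < h &
    forall (I : finType) (w : I -> R) (x : I -> 'rV[R]_p),
    (forall i, 0 <= w i) -> \sum_i w i = 1 -> wenergy w x <= h ->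
    `|\sum_i w i * phi (x i) - c| <= e.

(** With an empirical substitute [m] for the mean of the Gaussian, the distance to
    [m] is a Gaussian sum against weights of mass zero, and the distance from [m]
    to the mean is part of the quantity made small by the sample. *)
Lemma energy_controls_gauss s z : 0 <= s -> energy_controls (gauss s z).
Proof.
rewrite le_eqVlt => /predU1P[<-|s0].
  exists 1.
    by apply: mean_is_ext (mean_is_cst P 1) => y; rewrite gauss0.
  move=> e e0; exists 1 => // I w x _ w1 _.
  under eq_bigr do rewrite gauss0 mulr1.
  by rewrite w1 subrr normr0 ltW.
have g01 y : 0 <= gauss s z y <= 1 by rewrite gauss_ge0 gauss_le1.
have [c c01 gc] := mean_is_bounded P (measurable_gauss s z) g01.
have [||v v01 gv] := @mean_is_bounded _ _ _ P (fun y => (gauss s z y - c) ^+ 2).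
- under eq_fun do rewrite expr2.
  by apply: measurable_funM; apply: measurable_funB => //; exact: measurable_gauss.
- by move=> y; have := g01 y; rewrite sqr_ge0/=; nra.
exists c => // e e0.
have e2 : 0 < e / 2 by rewrite divr_gt0.
(* [C] is the constant of [gauss_sum_cube_le]; the sample at most doubles [h]. *)
pose C := 192 * s * Num.sqrt (pi : R).
have C0 : 0 < C by rewrite !mulr_gt0// sqrtr_gt0 pi_gt0.
pose h := Num.min ((e / 2) ^+ 2) ((e / 2) ^+ 3 / C) / 2.
have h0 : 0 < h by rewrite divr_gt0// lt_min !exprn_gt0//= divr_gt0// exprn_gt0.
exists h => // I w x w0 w1 wh.
have [n n0 nle] := natV_small (mu + v) h0.
have [y yle] := exists_empirical x w1 gc gv n0.
move: yle; set w' := (fun i : I + 'I_n => _); set x' := (fun i : I + 'I_n => _).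
have w'0 : \sum_i w' i = 0 by exact: sum_signed_weights.
have n1 : 0 < n%:R :> R by rewrite ltr0n.
have w'2 : \sum_i `|w' i| <= 2.
  rewrite big_sumType/= sum_ord_const normrN gtr0_norm ?invr_gt0//.
  rewrite divff ?gt_eqF//.
  by under eq_bigr do rewrite ger0_norm//; rewrite w1.
have := dist_form_ge0 x' w'0.
have := gauss_sum_cube_le x' z w'0 w'2 s0.
rewrite mulrA -/C; set D := dist_form _ _; set m := n%:R^-1 * _ => q3 D0 H.
have hh : h * 2 <= (e / 2) ^+ 2 by rewrite divfK// ge_min lexx.
have hC : h * 2 * C <= (e / 2) ^+ 3.
  by rewrite -ler_pdivlMr// divfK// ge_min lexx orbT.
have m2 := sqr_ge0 (m - c).
have Dh : D <= h * 2 by lra.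
have mc : `|m - c| <= e / 2.
  rewrite -(@ler_sqr _ `|m - c|) ?nnegrE ?normr_ge0 ?(ltW e2)// real_normK ?num_real//; lra.
have E : \sum_i w' i * gauss s z (x' i) = \sum_i w i * gauss s z (x i) - m.
  rewrite big_sumType/= /m mulr_sumr -sumrN; congr (_ + _).
  by apply: eq_bigr => j _; rewrite mulNr.
have qm : `|\sum_i w i * gauss s z (x i) - m| <= e / 2.
  rewrite -E -(@ler_pXn2r _ 3) ?nnegrE ?normr_ge0 ?(ltW e2)//.
  by apply: le_trans q3 _; apply: le_trans hC; rewrite mulrC ler_pM2r.
rewrite (_ : _ - c = (\sum_i w i * gauss s z (x i) - m) + (m - c)); last by ring.
by apply: le_trans (ler_normD _ _) _; lra.
Qed.

Lemma energy_controls_lin a b phi psi :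
  energy_controls phi -> energy_controls psi ->
  energy_controls (fun y => a * phi y + b * psi y).
Proof.
move=> [c phic Hc] [k psik Hk]; exists (a * c + b * k).
  exact: mean_isD (mean_isZ a phic) (mean_isZ b psik).
move=> e e0; pose M := `|a| + `|b| + 1.
have M0 : 0 < M by rewrite ltr_wpDl// addr_ge0.
have [h h0 hH] := Hc _ (divr_gt0 e0 M0).
have [l l0 lH] := Hk _ (divr_gt0 e0 M0).
exists (Num.min h l); first by rewrite lt_min h0.
move=> I w x w0 w1; rewrite le_min => /andP[/(hH I w x w0 w1) A /(lH I w x w0 w1) B].
have -> : \sum_i w i * (a * phi (x i) + b * psi (x i)) - (a * c + b * k) =
    a * (\sum_i w i * phi (x i) - c) + b * (\sum_i w i * psi (x i) - k).
  rewrite !mulrBr !mulr_sumr addrACA -opprD -big_split/=; congr (_ - _).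
  by apply: eq_bigr => i _; ring.
apply: le_trans (ler_normD _ _) _; rewrite !normrM.
apply: (@le_trans _ _ (`|a| * (e / M) + `|b| * (e / M))).
  by rewrite lerD// ler_wpM2l.
rewrite -mulrDl mulrA ler_pdivrMr// mulrC ler_wpM2l ?(ltW e0)//.
by rewrite lerDl.
Qed.

Lemma energy_controls_ext phi psi :
  phi =1 psi -> energy_controls phi -> energy_controls psi.
Proof. by move=> /funext->. Qed.

End weighted_energy.

(** * Test functions for orthants *)

Section orthant_test_functions.
Context {R : realType} {p : nat}.
Implicit Types (x y z t : 'rV[R]_p).

(** Completing the square; this makes the linear span of the Gaussians an
    algebra. *)
Lemma gaussM (s r : R) z u : 0 <= s -> 0 <= r ->
  exists k q v, 0 <= q /\
    forall y, gauss s z y * gauss r u y = k * gauss q v y.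
Proof.
move=> s0 r0; have := addr_ge0 (sqr_ge0 s) (sqr_ge0 r).
set S := s ^+ 2 + r ^+ 2; rewrite le_eqVlt => /predU1P[S0|S0].
  have /andP[/eqP-> /eqP->] : (s == 0) && (r == 0).
    by rewrite -(sqrf_eq0 s) -(sqrf_eq0 r) -paddr_eq0 ?sqr_ge0// -/S -S0.
  exists 1, 0, 0; split=> [|y]; first exact: lexx.
  by rewrite 3!gauss0.
have S1 : S != 0 by rewrite gt_eqF.
exists (expR (- (s ^+ 2 * r ^+ 2 / S * enorm (z - u) ^+ 2))), (Num.sqrt S),
  (\row_j ((s ^+ 2 * z 0 j + r ^+ 2 * u 0 j) / S)).
split=> [|y]; first exact: sqrtr_ge0.
rewrite /gauss -expRD -expRD; congr expR.
rewrite 3!exprMn (@sqr_sqrtr _ S (ltW S0)) !sqr_enorm /dot.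
 rewrite -!opprD; congr (- _).
rewrite !mulr_sumr -!big_split/=; apply: eq_bigr => j _; rewrite !mxE.
rewrite /S in S1 *.
by field.
Qed.

Lemma continuous_enormB z : continuous (fun x => enorm (x - z)).
Proof.
move=> x; apply: (@continuous_comp _ _ _
  (fun y : 'rV[R]_p => \sum_j (y - z) 0 j ^+ 2) Num.sqrt); last exact: sqrt_continuous.
apply: (cvg_finsum (F := nbhs x)) => j; rewrite expr2; under eq_fun do rewrite expr2 !mxE.
have cx : ((fun y : 'rV[R]_p => y 0 j) @ x --> x 0 j)%classic.
  exact: coord_continuous.
have c : ((fun y : 'rV[R]_p => y 0 j - z 0 j) @ x --> x 0 j - z 0 j)%classic.
  exact: (cvgB cx (cvg_cst (z 0 j))).
rewrite !mxE; exact: (cvgM c c).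
Qed.

Lemma closed_lower_orthant t : closed (lower_orthant t).
Proof.
rewrite (_ : lower_orthant t =
  \bigcap_(j in [set: 'I_p]%classic) [set y | y 0 j <= t 0 j]%classic)%classic; last first.
  by apply/seteqP; split => y H j; [move=> _; exact: H|exact: H].
apply: closed_bigI => j _.
apply: (@closed_comp _ _ (fun y : 'rV[R]_p => y 0 j) [set r | r <= t 0 j]%classic).
  by move=> y _; exact: coord_continuous.
exact: closed_le.
Qed.

(** The net lies inside the orthant, so that small balls around its points stay
    inside a slightly larger orthant. *)
Lemma lower_orthant_net t z0 (M rho : R) : 0 < rho ->
  exists2 Z : seq 'rV[R]_p, (forall z, z \in Z -> lower_orthant t z) &
    forall x, lower_orthant t x -> enorm (x - z0) <= M ->
      exists2 z, z \in Z & enorm (x - z) < rho.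
Proof.
move=> rho0; pose A := (lower_orthant t `&` [set x | enorm (x - z0) <= M])%classic.
have cA : compact A.
  apply: bounded_closed_compact.
    exists (M + `|z0|); split; first exact: num_real.
    move=> N MN x [_ /= xM]; apply: le_trans (ltW MN).
    rewrite -[x](subrK z0); apply: le_trans (ler_normD _ _) _; rewrite lerD2r.
    apply: le_trans xM; rewrite /Num.norm/= mx_normrE.
    apply: bigmax_le => [|[i j] _]; first exact: enorm_ge0.
    by rewrite /= ord1; exact: le_coord_enorm.
  apply: closedI; first exact: closed_lower_orthant.
  apply: (@closed_comp _ _ (fun x => enorm (x - z0)) [set r | r <= M]%classic).
    by move=> y _; exact: continuous_enormB.
  exact: closed_le.
move: cA; rewrite compact_cover => /(_ _ A (fun z => [set x | enorm (x - z) < rho]%classic)).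
case=> [z Az||D DA Dcov].
- apply: (@open_comp _ _ (fun x => enorm (x - z)) [set r | r < rho]%classic).
    by move=> y _; exact: continuous_enormB.
  exact: open_lt.
- by move=> x Ax; exists x => //=; rewrite enormxx.
exists (finmap.enum_fset D) => [z zD|x tx xM].
  by have /set_mem[] := DA _ zD.
have [z /= zD xz] := Dcov x (conj tx xM).
by exists z.
Qed.

Lemma prod_onem_itv (Z : seq 'rV[R]_p) (a : 'rV[R]_p -> R) :
  (forall z, 0 <= a z <= 1) -> 0 <= \prod_(z <- Z) (1 - a z) <= 1.
Proof.
move=> a01; rewrite prodr_ge0 => [|z _]; last by have := a01 z; lra.
by apply: prodr_ile1 => z _; have := a01 z; lra.
Qed.

Lemma onem_prod_le (Z : seq 'rV[R]_p) (a : 'rV[R]_p -> R) (b : R) :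
  (forall z, 0 <= a z <= 1) -> (forall z, z \in Z -> a z <= b) ->
  1 - \prod_(z <- Z) (1 - a z) <= (size Z)%:R * b.
Proof.
move=> a01; elim: Z => [|z Z IH] ab; first by rewrite big_nil subrr mul0r.
rewrite big_cons/= -natr1.
have /andP[z0 z1] := a01 z; have zb := ab z (mem_head _ _).
have IHZ : 1 - \prod_(z <- Z) (1 - a z) <= (size Z)%:R * b.
  by apply: IH => u uZ; apply: ab; rewrite inE uZ orbT.
have /andP[_] := prod_onem_itv Z a01.
move: (\prod_(z <- Z) _) IHZ => q; nra.
Qed.

Context (P : probability 'rV[R]_p R) (X : set 'rV[R]_p).
Context (PX : {ae P, forall y, X y}) (Efin : finite_energy P X).

(* A property strong enough to be preserved by multiplication by
   [1 - gauss r u]. *)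
Let controls_gaussM (phi : 'rV[R]_p -> R) := forall s z, 0 <= s ->
  energy_controls P (fun y => phi y * gauss s z y).

Let controls_onem phi r u : 0 <= r -> controls_gaussM phi ->
  controls_gaussM (fun y => phi y * (1 - gauss r u y)).
Proof.
move=> r0 Hphi s z s0; have [k [q [v [q0 E]]]] := gaussM u z r0 s0.
have := energy_controls_lin 1 (- k) (Hphi s z s0) (Hphi q v q0).
by apply: energy_controls_ext => y; have := E y => {}E; rewrite -mulrA mulrBl E; ring.
Qed.

Let controls_onemX phi r u n : 0 <= r -> controls_gaussM phi ->
  controls_gaussM (fun y => phi y * (1 - gauss r u y) ^+ n).
Proof.
move=> r0 Hphi; elim: n => [|n IH].
  by move=> s z s0; apply: energy_controls_ext (Hphi s z s0) => y; rewrite mulr1.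
move=> s z s0; apply: energy_controls_ext (@controls_onem _ r u r0 IH s z s0) => y.
by rewrite exprSr mulrA.
Qed.

Lemma energy_controls_onem_prod (Z : seq 'rV[R]_p) (r : R) (n : nat) : 0 <= r ->
  energy_controls P (fun y => 1 - \prod_(z <- Z) (1 - gauss r z y) ^+ n).
Proof.
move=> r0.
have one : controls_gaussM (fun=> 1).
  move=> s z s0; apply: energy_controls_ext (energy_controls_gauss PX Efin z s0) => y.
  by rewrite mul1r.
have H : controls_gaussM (fun y => \prod_(z <- Z) (1 - gauss r z y) ^+ n).
  elim: Z => [|z Z IH].
    by move=> s u s0; apply: energy_controls_ext (one s u s0) => y; rewrite big_nil.
  move=> s u s0; apply: energy_controls_ext (@controls_onemX _ r z n r0 IH s u s0) => y.
  by rewrite big_cons [X in _ = X * _]mulrC.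
apply: energy_controls_ext
  (energy_controls_lin 1 (- 1) (one 0 0 (lexx _)) (H 0 0 (lexx _))) => y.
by rewrite gauss0 !mulr1 mulN1r.
Qed.

(** The test function is a soft union of bumps centred at a net of the orthant.
    Let [al] be the value of the Gaussian at distance [delta / 2], the mesh of the
    net; its value at distance [delta] is [al^4].  With [n] of order [al^-2], the
    bump [1 - (1 - gauss)^n] is at least [1 - al] within the mesh and at most
    [2 * al] beyond distance [delta], and [al] is as small as desired. *)
Lemma exists_orthant_test t z0 (M delta e : R) : 0 < delta -> 0 < e ->
  exists2 psi, energy_controls P psi & forall x,
    [/\ 0 <= psi x <= 1,
        lower_orthant t x -> enorm (x - z0) <= M -> 1 - e <= psi x
      & ~ lower_orthant (t + const_mx delta) x -> psi x <= e].
Proof.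
move=> d0 e0; have d2 : 0 < delta / 2 by rewrite divr_gt0.
have [Z Zt Znet] := lower_orthant_net t z0 M d2.
pose C : R := (size Z)%:R * 2 + 1.
have C0 : 0 < C by rewrite ltr_wpDl// mulr_ge0.
pose K := C / e; have K0 : 0 < K by rewrite divr_gt0.
pose tau := K / (delta / 2); have tau0 : 0 < tau by rewrite divr_gt0.
pose al := expR (- K ^+ 2); have al0 : 0 < al by exact: expR_gt0.
have al1 : al <= 1 by rewrite expR_le1 oppr_le0 sqr_ge0.
have alC : al * C <= e.
  rewrite /al expRN ler_pdivrMl ?expR_gt0//.
  have : K <= expR (K ^+ 2) by have := expR_ge1Dx (K ^+ 2); nra.
  by rewrite ler_pdivrMr// mulrC.
pose n := (Num.trunc (al ^- 2)).+1.
have /andP[n1 n2] : (Num.trunc (al ^- 2))%:R <= al ^- 2 < n%:R.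
  by apply: truncn_itv; rewrite invr_ge0 exprn_ge0// ltW.
have n3 : n%:R * al ^+ 2 <= 2.
  have a2 : 0 < al ^+ 2 by rewrite exprn_gt0.
  rewrite -ler_pdivlMr//.
  have : 1 <= al ^- 2 by rewrite invf_ge1// expr_le1// ltW.
  have : n%:R = (Num.trunc (al ^- 2))%:R + 1 :> R by rewrite natr1.
  by move: (n%:R) (al ^- 2) ((Num.trunc _)%:R) n1 => c b a; lra.
have n4 : 1 <= n%:R * al ^+ 2.
  by rewrite -ler_pdivrMr ?exprn_gt0// mul1r ltW.
have g01 z x : 0 <= 1 - (1 - gauss tau z x) ^+ n <= 1.
  have := gauss_ge0 tau z x; have := gauss_le1 tau z x => g1 g0.
  rewrite subr_ge0 gerBl exprn_ge0 ?subr_ge0// andbT.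
  by rewrite exprn_ile1 ?subr_ge0// gerBl.
exists (fun y => 1 - \prod_(z <- Z) (1 - gauss tau z y) ^+ n).
  by apply: energy_controls_onem_prod; exact: ltW.
move=> x; have E (S : seq 'rV[R]_p) : \prod_(z <- S) (1 - gauss tau z x) ^+ n
    = \prod_(z <- S) (1 - (1 - (1 - gauss tau z x) ^+ n)).
  by apply: eq_bigr => z _; rewrite subKr.
split.
- by have := @prod_onem_itv Z (fun z => 1 - (1 - gauss tau z x) ^+ n) (g01^~ x); rewrite -E; lra.
- move=> tx xM; have [z zZ xz] := Znet x tx xM.
  rewrite lerD2l lerN2.
  have ga : al <= gauss tau z x.
    rewrite ler_expR lerN2 ler_sqr ?nnegrE ?(ltW K0)//; last first.
      by apply: mulr_ge0; [exact: ltW|exact: enorm_ge0].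
   
    by rewrite /tau mulrAC ler_pdivrMr// ler_pM2l// ltW.
  have : (1 - gauss tau z x) ^+ n <= al.
    apply: (@le_trans _ _ (expR (- al) ^+ n)).
      rewrite lerXn2r ?nnegrE ?subr_ge0 ?gauss_le1 ?expR_ge0//.
      by apply: le_trans (expR_ge1Dx (- al)); rewrite lerD2l lerN2.
    rewrite -expRM_natl mulrN expRN -(ler_pM2l (expR_gt0 (n%:R * al))).
    rewrite divff ?expR_eq0//.
    apply: (@le_trans _ _ (n%:R * al * al)).
      by rewrite -mulrA -expr2.
    by rewrite ler_wpM2r ?(ltW al0)//; have := expR_ge1Dx (n%:R * al); lra.
  move=> gal; rewrite (big_rem z zZ)/= E.
  have /andP[q0 q1] := prod_onem_itv (rem z Z) (g01^~ x).
  apply: le_trans (ler_piMr _ q1) _; first by rewrite exprn_ge0// subr_ge0 gauss_le1.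
  apply: le_trans gal (le_trans _ alC).
  by rewrite ler_peMr ?(ltW al0)// lerDr mulr_ge0.
- move=> tx; rewrite E.
  have tau2 : tau * delta = 2 * K by rewrite /tau; field; rewrite gt_eqF.
  have gfar z : z \in Z -> 1 - (1 - gauss tau z x) ^+ n <= 2 * al.
    move=> /Zt tz.
    have dz : delta <= enorm (x - z).
      rewrite leNgt; apply/negP => xz; apply: tx => j; rewrite !mxE.
      have := le_coord_enorm (x - z) j; have := tz j; rewrite !mxE.
      have := ler_norm (x 0 j - z 0 j); lra.
    have ga : gauss tau z x <= al ^+ 4.
      rewrite -expRM_natl ler_expR.
      have : (2 * K) ^+ 2 <= (tau * enorm (x - z)) ^+ 2.
        have K2 : 0 <= 2 * K by apply: mulr_ge0 (ltW K0).
        have te := mulr_ge0 (ltW tau0) (enorm_ge0 (x - z)).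
        by rewrite ler_sqr// -tau2 ler_pM2l.
      lra.
    apply: (@le_trans _ _ (n%:R * gauss tau z x)).
      have : 1 - n%:R * gauss tau z x <= (1 - gauss tau z x) ^+ n.
        elim: n {n1 n2 n3 n4 g01 E} => [|k IH]; first by rewrite mul0r subr0.
        rewrite exprS -natr1; have := gauss_ge0 tau z x.
        have := gauss_le1 tau z x; move: (gauss tau z x) IH => g.
        have := ler0n R k; move: (k%:R : R) ((1 - g) ^+ k) => N q; nra.
      by rewrite lerBlDr -lerBlDl.
    apply: (@le_trans _ _ (n%:R * al ^+ 2 * al ^+ 2)).
      by rewrite -mulrA -exprD ler_wpM2l.
    have : al ^+ 2 <= al by rewrite expr2 ler_piMr// ltW.
    have := sqr_ge0 al; move: (n%:R * al ^+ 2) (al ^+ 2) n3 => A B; nra.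
  apply: le_trans (onem_prod_le (g01^~ x) gfar) _.
  apply: le_trans alC; rewrite /C; move: (size Z)%:R => N; lra.
Qed.

End orthant_test_functions.

(** * Small energy and distribution functions *)

Section cdf_control.
Context {R : realType} {p : nat}.
Context (P : probability 'rV[R]_p R) (X : set 'rV[R]_p).
Context (PX : {ae P, forall y, X y}) (Efin : finite_energy P X).

Lemma mean_is_lower_orthant (t : 'rV[R]_p) :
  mean_is P (\1_(lower_orthant t)) (joint_cdf P t).
Proof.
have mt : measurable (lower_orthant t).
  rewrite -[lower_orthant t]setCK; apply: measurableC.
  apply: sub_sigma_algebra; apply: closed_openC; exact: closed_lower_orthant.
split; first exact: integrable_indic.
rewrite integral_indic// setIT /joint_cdf fineK//.
exact: fin_num_measure.
Qed.

(** Finiteness of the first moment makes wide Gaussians have mean close to one. *)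
Lemma exists_wide_gauss (e : R) : 0 < e ->
  exists2 s, 0 < s & exists2 c, mean_is P (gauss s 0) c & 1 - e <= c.
Proof.
move=> e0; pose m := fine (mean_dist_to P 0).
have m0 : 0 <= m by exact: mean_dist_to_ge0 PX Efin 0.
pose s := e / (m + 1); have s0 : 0 < s by rewrite divr_gt0// ltr_wpDl.
have g01 (y : 'rV[R]_p) : 0 <= gauss s 0 y <= 1 by rewrite gauss_ge0 gauss_le1.
have [c _ gc] := mean_is_bounded P (@measurable_gauss _ _ s 0) g01.
exists s => //; exists c => //; rewrite lerBlDr addrC -lerBlDr.
have := mean_is_le _ (mean_isB (mean_is_cst P 1) gc)
  (mean_isZ s (mean_is_dist PX Efin 0)).
move=> H; apply: le_trans (H _) _; last first.
  by rewrite /s -mulrA ler_piMr ?(ltW e0)// mulrC ler_pdivrMr ?ltr_wpDl// mul1r lerDl.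
move=> y; rewrite enormC /gauss.
have v0 := mulr_ge0 (ltW s0) (enorm_ge0 (y - 0)); move: (s * _) v0 => v v0.
have := onem_expRN_itv (sqr_ge0 v); rewrite le_min => /andP[_ /andP[v1 v2]].
have [vle|vlt] := leP v 1; last by apply: le_trans v1 (ltW vlt).
by apply: le_trans v2 _; rewrite expr2 ler_piMr.
Qed.

(** The test function accounts for the ball of radius [1 / s]; outside of it the
    Gaussian of scale [s] is at most [1 / 2], so that [2 * (1 - gauss s 0)]
    dominates the indicator. *)
Lemma cdf_sandwich (t : 'rV[R]_p) (delta e : R) : 0 < delta -> 0 < e ->
  exists2 h, 0 < h & forall (I : finType) (w : I -> R) (x : I -> 'rV[R]_p),
    (forall i, 0 <= w i) -> \sum_i w i = 1 -> wenergy P w x <= h ->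
    \sum_i w i * \1_(lower_orthant t) (x i)
      <= joint_cdf P (t + const_mx delta) + e /\
    joint_cdf P t <= \sum_i w i * \1_(lower_orthant (t + const_mx delta)) (x i) + e.
Proof.
move=> d0 e0; pose b := e / 8; have b0 : 0 < b by rewrite divr_gt0.
have [s s0 [cg gc cg1]] := exists_wide_gauss b0.
have [psi [cp psic Hp] psiP] := exists_orthant_test PX Efin t 0 s^-1 d0 b0.
have [cg' gc' Hg] := energy_controls_gauss PX Efin (0 : 'rV[R]_p) (ltW s0).
rewrite -(mean_is_uniq gc gc') {cg' gc'} in Hg.
have up y : \1_(lower_orthant t) y <= psi y + b + 2 * (1 - gauss s 0 y).
  have [/andP[q0 q1] q2 _] := psiP y.
  have g1 := gauss_le1 s 0 y.
  rewrite indicE; case: (boolP (y \in lower_orthant t)) => [/set_mem ty|_] /=; last by lra.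
  have [ys|ys] := leP (enorm (y - 0)) s^-1; first by have := q2 ty ys; lra.
  suff : gauss s 0 y <= 1 / 2 by lra.
  have v1 : 1 <= (s * enorm (y - 0)) ^+ 2.
    rewrite exprn_ege1// mulrC -ler_pdivrMr// mul1r; exact: ltW.
  rewrite /gauss expRN mul1r lef_pV2 ?posrE ?expR_gt0//.
  by have := expR_ge1Dx ((s * enorm (y - 0)) ^+ 2); lra.
have dn y : psi y <= \1_(lower_orthant (t + const_mx delta)) y + b.
  have [/andP[q0 q1] _ q2] := psiP y; rewrite indicE.
  case: (boolP (y \in _)) => [_|/negP ny] /=; first by rewrite ler_wpDr// ltW.
  by rewrite add0r; apply: q2 => ty; apply: ny; exact/mem_set.
have cup : joint_cdf P t <= cp + b + 2 * (1 - cg).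
  apply: mean_is_le up (mean_is_lower_orthant t) _.
  apply: mean_isD; first exact: mean_isD psic (mean_is_cst P b).
  exact: mean_isZ (mean_isB (mean_is_cst P 1) gc).
have cdn : cp <= joint_cdf P (t + const_mx delta) + b.
  apply: mean_is_le dn psic _.
  exact: mean_isD (mean_is_lower_orthant _) (mean_is_cst P b).
have [h h0 hP] := Hp _ b0; have [k k0 kP] := Hg _ b0.
exists (Num.min h k); first by rewrite lt_min h0.
move=> I w x w0 w1; rewrite le_min => /andP[/(hP I w x w0 w1) A /(kP I w x w0 w1) B].
move: A B; rewrite !ler_norml => /andP[A1 A2] /andP[B1 B2].
have wup : \sum_i w i * \1_(lower_orthant t) (x i) <=
    \sum_i w i * psi (x i) + b + 2 * (1 - \sum_i w i * gauss s 0 (x i)).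
  rewrite -[b]mul1r -[X in 2 * (X - _)]w1 -{1}w1 mulr_suml -sumrB mulr_sumr.
  rewrite -!big_split/=; apply: ler_sum => i _.
  apply: le_trans (ler_wpM2l (w0 i) (up (x i))) _.
  by rewrite le_eqVlt; apply/orP; left; apply/eqP; ring.
have wdn : \sum_i w i * psi (x i) <=
    \sum_i w i * \1_(lower_orthant (t + const_mx delta)) (x i) + b.
  rewrite -[b]mul1r -{1}w1 mulr_suml -big_split/=; apply: ler_sum => i _.
  by rewrite -mulrDr ler_wpM2l.
move: (\sum_i w i * \1_(lower_orthant t) _) wup => u wup.
move: (\sum_i w i * \1_(lower_orthant _) _) wdn => v wdn.
have bE : b = e / 8 by [].
by split; lra.
Qed.

(** Continuity at [t] closes the gap of [cdf_sandwich], applied at [t] and at a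
    point slightly below [t]. *)
Lemma cdf_close (t : 'rV[R]_p) (e : R) :
  {for t, continuous (joint_cdf P)}%classic -> 0 < e ->
  exists2 h, 0 < h & forall (I : finType) (w : I -> R) (x : I -> 'rV[R]_p),
    (forall i, 0 <= w i) -> \sum_i w i = 1 -> wenergy P w x <= h ->
    `|joint_cdf P t - \sum_i w i * \1_(lower_orthant t) (x i)| <= e.
Proof.
move=> /cvgrPdist_le ct e0; have e2 : 0 < e / 2 by rewrite divr_gt0.
have [r /= r0 Hr] := (nbhs_ballP _ _).1 (ct _ e2).
have r2 : 0 < r / 2 by rewrite divr_gt0.
have near_t (a : R) : `|a| < r -> `|joint_cdf P t - joint_cdf P (t + const_mx a)| <= e / 2.
  move=> ar; apply: Hr; split=> // i j; rewrite !mxE /ball/= opprD addrA subrr sub0r normrN.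
  exact: ar.
have Fp := near_t (r / 2); have Fm := near_t (- (r / 2)).
have [h h0 H] := cdf_sandwich t r2 e2.
have [k k0 K] := cdf_sandwich (t + const_mx (- (r / 2))) r2 e2.
exists (Num.min h k); first by rewrite lt_min h0.
move=> I w x w0 w1; rewrite le_min => /andP[/(H I w x w0 w1)[A _] /(K I w x w0 w1)[_ B]].
have E : t + const_mx (- (r / 2)) + const_mx (r / 2) = t.
  by apply/matrixP => i j; rewrite !mxE addrNK.
rewrite E in B.
have r2r : `|r / 2| < r by rewrite gtr0_norm//; lra.
move: (Fp r2r) (Fm); rewrite normrN => {Fm}Fp /(_ r2r) Fm.
move: Fp Fm; rewrite !ler_norml => /andP[Fp1 Fp2] /andP[Fm1 Fm2].
move: (\sum_i _) A B => u A B; apply/andP; split; lra.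
Qed.

End cdf_control.

(** * First moments of sets of small energy *)

Section first_moment.
Context {R : realType} {p : nat}.
Context (P : probability 'rV[R]_p R) (X : set 'rV[R]_p).
Context (PX : {ae P, forall y, X y}) (Efin : finite_energy P X).

Lemma enormZ (a : R) (v : 'rV[R]_p) : enorm (a *: v) = `|a| * enorm v.
Proof.
rewrite /enorm -sqrtr_sqr -sqrtrM ?sqr_ge0//; congr Num.sqrt.
by rewrite mulr_sumr; apply: eq_bigr => j _; rewrite mxE exprMn.
Qed.

Lemma wenergy_cat (I J : finType) (w : I -> R) (x : I -> 'rV[R]_p)
    (v : J -> R) (y : J -> 'rV[R]_p) :
  wenergy P (fun i : I + J => match i with inl i => w i | inr j => v j end)
    (fun i : I + J => match i with inl i => x i | inr j => y j end)
  = wenergy P w x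
    + 2 * (\sum_j v j * (fine (mean_dist_to P (y j))
                        - \sum_i w i * enorm (x i - y j)))
    + dist_form v y.
Proof.
rewrite /wenergy /dist_form !big_sumType/=.
under [X in _ - (X + _) - _]eq_bigr do rewrite big_sumType/=.
under [X in _ - (_ + X) - _]eq_bigr do rewrite big_sumType/=.
rewrite !big_split/=.
have -> : \sum_j v j * (fine (mean_dist_to P (y j)) - \sum_i w i * enorm (x i - y j))
    = \sum_j v j * fine (mean_dist_to P (y j))
      - \sum_j \sum_i v j * w i * enorm (y j - x i).
  rewrite -sumrB; apply: eq_bigr => j _; rewrite mulrBr mulr_sumr; congr (_ - _).
  by apply: eq_bigr => i _; rewrite enormC mulrA.
have -> : \sum_i \sum_j w i * v j * enorm (x i - y j)
    = \sum_j \sum_i v j * w i * enorm (y j - x i).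
  rewrite exchange_big; apply: eq_bigr => j _; apply: eq_bigr => i _.
  by rewrite enormC (mulrC (w i)).
move: (\sum_i \sum_j w i * w j * _) (\sum_i \sum_j v i * v j * _)
  (\sum_j \sum_i v j * w i * _) => A B C.
move: (\sum_i w i * _) (\sum_j v j * _) => D E; ring.
Qed.

(** The second difference [|y - z| + |y + z| - 2 |y|] is a bump of height [2 |z|]
    at the origin and of width [|z|]. *)
Lemma second_diff_bounds (y z : 'rV[R]_p) :
  2 * enorm z - 2 * enorm y <= enorm (y - z) + enorm (y + z) /\
  (enorm y <= enorm z -> enorm (y - z) + enorm (y + z) <= 2 * enorm z + enorm y).
Proof.
have E : enorm (y - z) ^+ 2 + enorm (y + z) ^+ 2
    = 2 * enorm y ^+ 2 + 2 * enorm z ^+ 2.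
  rewrite !sqr_enorm /dot !mulr_sumr -!big_split/=.
  by apply: eq_bigr => j _; rewrite !mxE; ring.
have A0 := enorm_ge0 (y - z); have B0 := enorm_ge0 (y + z).
have y0 := enorm_ge0 y; have z0 := enorm_ge0 z.
split=> [|yz].
  have := enormB_le z 0 y; rewrite !subr0 enormC.
  have := enormB_le (- z) 0 y; rewrite !subr0 enormN (_ : - z - y = - (y + z)).
    by rewrite enormN; lra.
  by rewrite opprD addrC.
move: (enorm (y - z)) (enorm (y + z)) (enorm y) (enorm z) E A0 B0 y0 z0 yz.
move=> A B a r E A0 B0 a0 r0 ar.
rewrite -ler_sqr ?nnegrE ?addr_ge0 ?mulr_ge0//.
have := sqr_ge0 (A - B); nra.
Qed.

(** Energy [mu / n] keeps the first moment of [n] points bounded: perturbing the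
    points by small masses at [z], [- z] and [0] cannot make the energy negative,
    and the bump carried by these masses, taken at the scale of the first moment
    itself, separates the points from a neighbourhood of the origin. *)
Lemma first_moment_le (n : nat) (x : 'I_n -> 'rV[R]_p) : (0 < n)%N ->
  energy P x [set: 'I_n] <= fine (mean_dist P) / n%:R ->
  \sum_i enorm (x i)
    <= 6 * n%:R * (fine (mean_dist_to P 0) + fine (mean_dist P)).
Proof.
move=> n0; rewrite energyE.
have m0 := mean_dist_to_ge0 PX Efin 0; have mu0 := mean_dist_ge0 PX Efin.
have n1 : 0 < n%:R :> R by rewrite ltr0n.
set w := unif _; set E := wenergy _ _ _; set m := fine (mean_dist_to P 0) in m0 *.
set mu := fine (mean_dist P) in mu0 * => Emu.
set r := \sum_i enorm (x i).
have r0 : 0 <= r by apply: sumr_ge0 => i _; exact: enorm_ge0.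
have := r0; rewrite le_eqVlt => /predU1P[<-|r1].
  by rewrite mulr_ge0 ?addr_ge0// mulr_ge0// ltW.
have [j xj0] : exists j, 0 < enorm (x j).
  apply/existsP; apply: contraTT r1; rewrite negb_exists => /forallP H.
  rewrite -leNgt; apply: sumr_le0 => i _; rewrite leNgt; exact: H.
pose z := (r / enorm (x j)) *: x j.
have zr : enorm z = r.
  by rewrite /z enormZ ger0_norm ?divr_ge0 ?(ltW xj0)// divfK// gt_eqF.
(* A mass of order [1 / n] balances the linear gain [t * r / n] against the cost
   [t^2 * r] of the added masses. *)
pose t := (8 * n%:R)^-1 : R.
pose v (k : unit + unit + unit) := if k is inl _ then - t else 2 * t.
pose y (k : unit + unit + unit) : 'rV[R]_p :=
  match k with inl (inl _) => z | inl (inr _) => - z | inr _ => 0 end.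
have w1 : \sum_i w i = 1 by apply: unif_sum1; rewrite cardsT card_ord.
have wv1 : \sum_(i : 'I_n + (unit + unit + unit))
    match i with inl i => w i | inr k => v k end = 1.
  by rewrite !big_sumType/= !sum_unit w1 /v; ring.
have := wenergy_ge0 PX Efin
  (fun i : 'I_n + (unit + unit + unit) => match i with inl i => x i | inr k => y k end) wv1.
rewrite wenergy_cat /dist_form !big_sumType/= !sum_unit.
rewrite !big_sumType/= !sum_unit /= !enormxx.
have zz : enorm (z - - z) = 2 * r.
  by rewrite opprK -mulr2n -scaler_nat enormZ zr ger0_norm.
have zz' : enorm (- z - z) = 2 * r by rewrite -opprD enormN -zz opprK.
rewrite zz zz' !subr0 !sub0r !enormN zr -/E -/m.
have sumw F : \sum_i w i * F i = n%:R^-1 * \sum_i F i.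
  rewrite sum_unif cardsT card_ord; congr (_ * _).
  by apply: eq_bigl => i; rewrite inE.
rewrite !sumw.
have phiP : 2 * r - 2 * m <= fine (mean_dist_to P z) + fine (mean_dist_to P (- z)).
  apply: mean_is_le (mean_isB (mean_is_cst P _) (mean_isZ 2 (mean_is_dist PX Efin 0)))
    (mean_isD (mean_is_dist PX Efin z) (mean_is_dist PX Efin (- z))) => u.
  have [H _] := second_diff_bounds u z.
  rewrite sub0r enormN -zr (enormC z) -(enormN (- z - u)) opprB opprK addrC.
  by rewrite [leRHS]addrC (addrC u z) in H *; lra.
have phiQ : \sum_i enorm (x i - z) + \sum_i enorm (x i - - z)
    <= 2 * n%:R * r + \sum_i enorm (x i).
  rewrite -big_split/= (_ : 2 * n%:R * r = \sum_(i < n) 2 * r); last first.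
    by rewrite sum_ord_const; ring.
  rewrite -big_split/=; apply: ler_sum => i _.
  have [_ H] := second_diff_bounds (x i) z; rewrite opprK -zr; apply: H.
  by rewrite zr /r (bigD1 i)//= lerDl sumr_ge0// => k _; exact: enorm_ge0.
rewrite -/r in phiQ *.
under [X in 2 * t * (m - _ * X)]eq_bigr do rewrite subr0.
rewrite -/r.
move: (\sum_i enorm (x i - z)) (\sum_i enorm (x i - - z)) phiQ => A B phiQ.
move: (fine _) (fine _) phiP => fz' fz phiP H.
have tE : t = n%:R^-1 / 8 by rewrite /t invfM mulrC.
move: (n%:R : R) n1 (n%:R^-1) (divff (lt0r_neq0 n1)) Emu tE H phiQ.
move=> N N0 V NV Emu tE H phiQ.
have V0 : 0 < V by rewrite -(pmulr_rgt0 _ N0) NV.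
have t0 : 0 < t by rewrite tE divr_gt0.
have h1 : t * V * (A + B) <= t * V * (2 * N * r + r).
  by rewrite ler_pM2l// mulr_gt0.
have h2 : t * (2 * r - 2 * m) <= t * (fz + fz') by rewrite ler_pM2l.
have h3 : t * V * (2 * N * r) = 2 * t * r.
  by rewrite -[RHS]mulr1 -NV; ring.
have h4 : V * (V * r) * (3 / 16) <= V * (mu + m).
  by rewrite tE in H h1 h2 h3; lra.
have h5 : V * r * (3 / 16) <= mu + m by rewrite -(ler_pM2l V0); lra.
have : N * (V * r * (3 / 16)) <= N * (mu + m) by rewrite (ler_pM2l N0).
have -> : N * (V * r * (3 / 16)) = (N * V) * r * (3 / 16) by ring.
by rewrite NV mul1r; have := mulr_ge0 (ltW N0) (addr_ge0 mu0 m0); lra.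
Qed.

End first_moment.

(** * Random partitions *)

Section random_partition.
Context {R : realType} {p : nat}.
Context (P : probability 'rV[R]_p R).

Lemma perm_sum (n : nat) (g : 'I_n -> R) i :
  n%:R * (\sum_(s : 'S_n) g (s i)) = n`!%:R * \sum_a g a.
Proof.
have T j : \sum_(s : 'S_n) g (s i) = \sum_(s : 'S_n) g (s j).
  rewrite (reindex_inj (mulgI (tperm i j))) /=; apply: eq_bigr => s _.
  by rewrite permM tpermL.
transitivity (\sum_j \sum_(s : 'S_n) g (s j)).
  by rewrite -(eq_bigr _ (fun j _ => T j)) sum_ord_const.
rewrite exchange_big/= -card_Sn mulr_natl -sumr_const.
apply: eq_bigr => s _; rewrite [RHS](reindex_inj (@perm_inj _ s)); exact: eq_bigr.
Qed.

Lemma perm_two_transitive (n : nat) (i j i' j' : 'I_n) : i != j -> i' != j' ->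
  exists2 t : 'S_n, t i = i' & t j = j'.
Proof.
move=> ij ij'; exists (tperm i i' * tperm (tperm i i' j) j')%g; last first.
  by rewrite permM tpermL.
have ne : tperm i i' j != i' by rewrite -[X in _ != X](tpermL i i') (inj_eq perm_inj) eq_sym.
by rewrite permM tpermL (tpermD ne)// eq_sym.
Qed.

(** The permutations act transitively on pairs of distinct indices, so all such
    pairs have the same sum. *)
Lemma perm_sum_pair (n : nat) (h : 'I_n -> 'I_n -> R) i j :
  (forall a, h a a = 0) -> i != j ->
  n%:R * (n%:R - 1) * (\sum_(s : 'S_n) h (s i) (s j))
  = n`!%:R * \sum_a \sum_b h a b.
Proof.
move=> h0 ij; set T := \sum_(s : 'S_n) _.
have HT i' j' : i' != j' -> \sum_(s : 'S_n) h (s i') (s j') = T.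
  move=> ij'; have [t ti tj] := perm_two_transitive ij ij'.
  rewrite /T [RHS](reindex_inj (mulgI t)); apply: eq_bigr => s _.
  by rewrite !permM ti tj.
transitivity (\sum_i' \sum_j' \sum_(s : 'S_n) h (s i') (s j')).
  transitivity (\sum_(i' < n) (n%:R - 1) * T).
    by rewrite sum_ord_const mulrA.
  apply: eq_bigr => i' _; rewrite (bigD1 i')//= big1 ?add0r => [|s _]; last exact: h0.
  rewrite (eq_bigr (fun=> T)) => [|j' ij']; last by apply: HT; rewrite eq_sym.
  rewrite sumr_const cardC1 card_ord -[RHS]mulr_natl; congr (_ * _).
  have n0 : (0 < n)%N := leq_ltn_trans (leq0n i') (ltn_ord i').
  by rewrite -[in LHS](prednK n0) -natr1 addrK.
transitivity (\sum_(s : 'S_n) \sum_a \sum_b h a b); last first.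
  by rewrite sumr_const card_Sn mulr_natl.
under eq_bigr do rewrite exchange_big/=.
rewrite exchange_big/=; apply: eq_bigr => s _.
rewrite [RHS](reindex_inj (@perm_inj _ s)); apply: eq_bigr => a _.
by rewrite [RHS](reindex_inj (@perm_inj _ s)).
Qed.

(** A uniformly random subset of given size: its mean energy exceeds the energy
    of the whole set only through the diagonal of the double sum. *)
Lemma perm_energy_le (n : nat) (x : 'I_n -> 'rV[R]_p) (A : {set 'I_n}) :
  (1 < n)%N -> (0 < #|A|)%N ->
  \sum_(s : 'S_n) energy P x (s @: A) <=
  n`!%:R * (energy P x [set: 'I_n]
    + (\sum_i \sum_j enorm (x i - x j)) / (#|A|%:R * n%:R ^+ 2)).
Proof.
move=> n1 A0; have AN : (#|A| <= n)%N by rewrite -[X in (_ <= X)%N]card_ord max_card.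
set S := \sum_i \sum_j _; set F := \sum_i fine (mean_dist_to P (x i)).
have S0 : 0 <= S by do 2!apply: sumr_ge0 => ? _; exact: enorm_ge0.
have sT (G : 'I_n -> R) : \sum_(i in [set: 'I_n]) G i = \sum_i G i.
  by apply: eq_bigl => i; rewrite inE.
rewrite [energy P x [set: 'I_n]]/energy sT -/F cardsT card_ord sT.
under [X in _ - _ * X - _]eq_bigr do rewrite sT.
rewrite -/S.
have eE (s : 'S_n) : energy P x (s @: A) =
    2 / #|A|%:R * (\sum_(i in A) fine (mean_dist_to P (x (s i))))
    - (#|A|%:R ^+ 2)^-1 * (\sum_(i in A) \sum_(j in A) enorm (x (s i) - x (s j)))
    - fine (mean_dist P).
  have sA (G : 'I_n -> R) : \sum_(i in s @: A) G i = \sum_(i in A) G (s i).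
    by rewrite big_imset//= => i j _ _; exact: perm_inj.
  rewrite /energy card_imset ?sA; last exact: perm_inj.
  by under [X in _ - _ * X - _]eq_bigr do rewrite sA.
rewrite (eq_bigr _ (fun s _ => eE s)) !sumrB -!mulr_sumr sumr_const card_Sn.
rewrite -[X in _ - X <= _]mulr_natl.
have N0 : 0 < n%:R :> R by rewrite ltr0n ltnW.
have N1 : 0 < n%:R - 1 :> R by rewrite subr_gt0 ltr1n.
have a0 : 0 < #|A|%:R :> R by rewrite ltr0n.
have a1 : 1 <= #|A|%:R :> R by rewrite ler1n.
have aN : #|A|%:R <= n%:R :> R by rewrite ler_nat.
have -> : \sum_(s : 'S_n) \sum_(i in A) fine (mean_dist_to P (x (s i)))
    = #|A|%:R * (n`!%:R * F / n%:R).
  rewrite exchange_big/= mulr_natl -sumr_const; apply: eq_bigr => i _.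
  rewrite -(perm_sum (fun i => fine (mean_dist_to P (x i))) i).
  by rewrite mulrAC divff ?mul1r// gt_eqF.
have -> : \sum_(s : 'S_n) \sum_(i in A) \sum_(j in A) enorm (x (s i) - x (s j))
    = #|A|%:R * (#|A|%:R - 1) * (n`!%:R * S / (n%:R * (n%:R - 1))).
  rewrite exchange_big/= -mulrA mulr_natl -sumr_const; apply: eq_bigr => i iA.
  rewrite exchange_big/= (bigD1 i)//= big1 ?add0r => [|s _]; last exact: enormxx.
  rewrite (eq_bigr (fun=> n`!%:R * S / (n%:R * (n%:R - 1)))) => [|j /andP[_ ji]].
    rewrite sumr_const -[LHS]mulr_natl; congr (_ * _).
    rewrite [in RHS](cardD1 i A) iA natrD addrAC subrr add0r; congr (_%:R).
    by apply: eq_card => j; rewrite !inE andbC.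
  rewrite -(@perm_sum_pair n (fun a b => enorm (x a - x b)) i j) => [||].
  - by rewrite mulrAC divff ?mul1r// mulf_neq0// gt_eqF.
  - by move=> a; exact: enormxx.
  - by rewrite eq_sym.
move: (#|A|%:R : R) (n%:R : R) (n`!%:R : R) (ler0n R n`!) a0 a1 aN N0 N1.
move: (fine _) => M a N f f0 a0 a1 aN N0 N1.
rewrite -subr_ge0 [leRHS](_ : _ = f * S * ((a - 1) / (a * N ^+ 2 * (N - 1)))).
  by rewrite !mulr_ge0// ?invr_ge0 ?subr_ge0// !mulr_ge0// ?exprn_ge0 ?ltW.
by field; rewrite ?gt_eqF.
Qed.

Lemma block_partition_perm (n K : nat) (m : 'I_K -> nat)
    (B : 'I_K -> {set 'I_n}) (s : 'S_n) :
  block_partition m B -> block_partition m (fun k => s @: B k).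
Proof.
move=> [Bm Bd Bu]; split=> [k|k l kl|].
- by rewrite card_imset//; exact: perm_inj.
- rewrite -setI_eq0 -imsetI; last by move=> i j _ _; exact: perm_inj.
  by have := Bd k l kl; rewrite -setI_eq0 => /eqP->; rewrite imset0.
- apply/setP => i; rewrite [RHS]inE; apply/bigcupP.
  have : (s^-1)%g i \in \bigcup_k B k by rewrite Bu inE.
  by move=> /bigcupP[k _ ik]; exists k => //; apply/imsetP; exists ((s^-1)%g i); rewrite ?permKV.
Qed.

(** An optimal partition does no worse than the average over its images under
    all permutations. *)
Lemma partition_cost_le (n K : nat) (m : 'I_K -> nat) (x : 'I_n -> 'rV[R]_p)
    (B : 'I_K -> {set 'I_n}) :
  (1 < n)%N -> (forall k, (0 < m k)%N) -> n = (\sum_k m k)%N ->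
  optimal_partition P m x B ->
  partition_cost P m x B <= energy P x [set: 'I_n]
    + K%:R * (\sum_i \sum_j enorm (x i - x j)) / n%:R ^+ 3.
Proof.
move=> n1 m0 nE [Bp Bopt]; have [Bm _ _] := Bp.
have f0 : 0 < n`!%:R :> R by rewrite ltr0n fact_gt0.
have N0 : 0 < n%:R :> R by rewrite ltr0n ltnW.
set S := \sum_i \sum_j _; set E := energy P x [set: 'I_n].
rewrite -(ler_pM2l f0).
apply: (@le_trans _ _ (\sum_(s : 'S_n) partition_cost P m x (fun k => s @: B k))).
  rewrite mulr_natl -card_Sn -sumr_const; apply: ler_sum => s _.
  by apply: Bopt; exact: block_partition_perm.
rewrite exchange_big/=.
apply: (@le_trans _ _ (\sum_k (m k)%:R / n%:R * (n`!%:R * (E + S / ((m k)%:R * n%:R ^+ 2))))).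
  apply: ler_sum => k _; rewrite -mulr_sumr ler_wpM2l ?divr_ge0//.
  by rewrite -(Bm k); apply: perm_energy_le => //; rewrite Bm.
have -> : n`!%:R * (E + K%:R * S / n%:R ^+ 3)
    = \sum_(k < K) ((m k)%:R / n%:R * (n`!%:R * E) + n`!%:R * S / n%:R ^+ 3).
  rewrite big_split/= sum_ord_const -mulr_suml -mulr_suml -natr_sum -nE.
  by field; rewrite gt_eqF.
apply: ler_sum => k _; rewrite le_eqVlt; apply/orP; left; apply/eqP.
by field; rewrite !gt_eqF// ltr0n.
Qed.

End random_partition.

(** * Optimal blocks *)

Section optimal_blocks.
Context {R : realType} {p : nat}.
Context (P : probability 'rV[R]_p R) (X : set 'rV[R]_p).
Context (PX : {ae P, forall y, X y}) (Efin : finite_energy P X).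

Lemma representative_energy_le (n : nat) (x : 'I_n -> 'rV[R]_p) : (0 < n)%N ->
  representative P X x -> energy P x [set: 'I_n] <= fine (mean_dist P) / n%:R.
Proof.
move=> n0 [_ xmin]; have [y Xy yle] := exists_energy_le PX Efin n0.
exact: le_trans (xmin y Xy) yle.
Qed.

(** The energy of the whole set and the excess of a random partition are both of
    order [1 / n]; as no block has negative energy, the cost of the optimal
    partition bounds the contribution of each block. *)
Lemma optimal_block_energy_le : exists2 C, 0 <= C &
  forall (n K : nat) (m : 'I_K -> nat) (x : 'I_n -> 'rV[R]_p)
    (B : 'I_K -> {set 'I_n}) (k : 'I_K),
  (1 < n)%N -> (forall k, (0 < m k)%N) -> n = (\sum_k m k)%N ->
  representative P X x -> optimal_partition P m x B ->
  (m k)%:R / n%:R * energy P x (B k) <= (1 + K%:R) * C / n%:R.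
Proof.
pose D := fine (mean_dist_to P 0) + fine (mean_dist P).
have m0 := mean_dist_to_ge0 PX Efin 0; have mu0 := mean_dist_ge0 PX Efin.
have D0 : 0 <= D by exact: addr_ge0.
exists (12 * D) => [|n K m x B k n1 mpos nE xr Bo]; first by rewrite mulr_ge0.
have n0 : (0 < n)%N by exact: ltnW.
have N0 : 0 < n%:R :> R by rewrite ltr0n.
have Ex := representative_energy_le n0 xr.
have Mx := first_moment_le PX Efin n0 Ex; rewrite -/D in Mx.
have [[Bm Bd Bu] _] := Bo.
have Bge0 l : 0 <= (m l)%:R / n%:R * energy P x (B l).
  rewrite mulr_ge0 ?divr_ge0// energyE (wenergy_ge0 PX Efin)//.
  by apply: unif_sum1; rewrite Bm.
have S_le : \sum_i \sum_j enorm (x i - x j) <= 2 * n%:R * \sum_i enorm (x i).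
  apply: (@le_trans _ _ (\sum_i \sum_j (enorm (x i) + enorm (x j)))).
    apply: ler_sum => i _; apply: ler_sum => j _.
    by have := enormB_le (x i) (x j) 0; rewrite subr0 sub0r enormN.
  under eq_bigr do rewrite big_split/= sum_ord_const.
  by rewrite big_split/= sum_ord_const -mulr_sumr; lra.
apply: (@le_trans _ _ (partition_cost P m x B)).
  by rewrite /partition_cost (bigD1 k)//= lerDl sumr_ge0.
apply: le_trans (partition_cost_le n1 mpos nE Bo) _.
rewrite mulrDl mul1r mulrDl; apply: lerD.
  apply: le_trans Ex _; rewrite ler_wpM2r ?invr_ge0 ?(ltW N0)//.
  by rewrite /D in D0 *; lra.
rewrite -!mulrA ler_wpM2l//.
rewrite ler_pdivrMr ?exprn_gt0//.
have -> : 12 * (D / n%:R) * n%:R ^+ 3 = 2 * n%:R * (6 * n%:R * D).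
  by field; rewrite gt_eqF.
by apply: le_trans S_le _; rewrite ler_wpM2l// mulr_ge0// ltW.
Qed.

End optimal_blocks.

Theorem theorem3 (R : realType) (p K : nat)
    (X : set 'rV[R]_p) (P : probability 'rV[R]_p R)
    (m : nat -> 'I_K -> nat) (c : 'I_K -> R)
    (x : forall n : nat, 'I_n -> 'rV[R]_p)
    (B : forall n : nat, 'I_K -> {set 'I_n})
    (PX : {ae P, forall y, X y})
    (Fcont : continuous (joint_cdf P))
    (Efin : finite_energy P X)
    (m_gt0 : forall n k, (K <= n)%N -> (0 < m n k)%N)
    (m_sum : forall n, (K <= n)%N -> n = (\sum_k m n k)%N)
    (c_gt0 : forall k, 0 < c k)
    (m_lim : forall k,
      ((m n k)%:R / n%:R @[n --> \oo] --> c k)%classic)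
    (x_repr : forall n, (K <= n)%N -> representative P X (x n))
    (B_opt : forall n, (K <= n)%N -> optimal_partition P (m n) (x n) (B n)) :
  forall k : 'I_K,
    cvg_in_distribution (fun n => edf (x n) (B n k)) (joint_cdf P).
Proof.
move=> k t ct; apply/cvgrPdist_le => e e0.
have [h h0 close] := cdf_close PX Efin ct e0.
have [C C0 block] := optimal_block_energy_le PX Efin.
have ck : 0 < c k / 2 by rewrite divr_gt0.
have b0 : 0 < h * (c k / 2) by exact: mulr_gt0.
have [N N0 NC] := natV_small ((1 + K%:R) * C) b0.
near=> n.
have Kn : (K <= n)%N by near: n; exact: nbhs_infty_ge.
have n1 : (1 < n)%N by near: n; exact: nbhs_infty_gt.
have Nn : (N <= n)%N by near: n; exact: nbhs_infty_ge.
have cn : c k / 2 <= (m n k)%:R / n%:R.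
  near: n; apply: cvgr_ge (m_lim k) _ _.
  by rewrite ltr_pdivrMr// ltr_pMr// ltr1n.
have [[Bm _ _] _] := B_opt n Kn.
have Bk0 : (0 < #|B n k|)%N by rewrite Bm m_gt0.
have w1 : \sum_i unif (B n k) i = 1 :> R by exact: unif_sum1.
rewrite /edf -sum_unif; apply: close => //; first exact: unif_ge0.
rewrite -energyE.
have E0 : 0 <= energy P (x n) (B n k) by rewrite energyE (wenergy_ge0 PX Efin).
have := block n K (m n) (x n) (B n) k n1 (fun l => m_gt0 n l Kn) (m_sum n Kn)
  (x_repr n Kn) (B_opt n Kn).
move=> H; rewrite -(ler_pM2r ck); apply: le_trans NC.
apply: (@le_trans _ _ ((1 + K%:R) * C / n%:R)).
  by apply: le_trans H; rewrite mulrC ler_wpM2r.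
have D0 : 0 <= (1 + K%:R) * C by rewrite mulr_ge0// addr_ge0.
by rewrite ler_wpM2l// lef_pV2 ?posrE ?ltr0n ?ler_nat// ltnW.
Unshelve. all: by end_near. Qed.
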